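(* Let $u:\mathbb{R}^n\to\mathbb{R}$ be a convex solution of $$\operatorname{div}\left(\frac{\nabla u(x)}{\sqrt{1-|\nabla u(x)|^2}}\right)=\frac{1}{\sqrt{1-|\nabla u(x)|^2}},\qquad |\nabla u(x)|<1,\qquad \forall x\in\mathbb{R}^n.$$ If the set $\Omega_0=\{x\in\mathbb{R}^n: (u_{ij}(x))>0\}$ is nonempty, then $\Omega_0=\mathbb{R}^n$.
   Context: Solutions are understood in the classical ($C^2$) sense. Here $(u_{ij}(x))$ denotes the Hessian matrix of $u$ at $x$, and $(u_{ij}(x))>0$ means that it is positive definite. *)

(* Defs.v *)
From HB Require Import structures.
From mathcomp Require Import all_boot all_order all_algebra.
From mathcomp Require Import all_classical all_reals all_analysis.

Set Implicit Arguments.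
Unset Strict Implicit.
Unset Printing Implicit Defensive.

Import Order.TTheory GRing.Theory Num.Theory.
Import numFieldNormedType.Exports.

Local Open Scope classical_set_scope.
Local Open Scope ring_scope.

Section VectorCalculus.
Context {R : realType} {n : nat}.
Implicit Types (f u : 'rV[R]_n -> R) (F : 'rV[R]_n -> 'rV[R]_n) (x : 'rV[R]_n).

(* The library norm `|v| on 'rV[R]_n is the sup norm, hence this definition. *)
Definition enorm (v : 'rV[R]_n) : R := Num.sqrt (\sum_i v 0 i ^+ 2).

(* Like 'D_v, this is a total function: it is only meaningful where the
   corresponding derivative exists. *)
Definition partial (i : 'I_n) f x : R := 'D_(delta_mx 0 i) f x.

Definition gradient f x : 'rV[R]_n := \row_i partial i f x.

Definition divergence F x : R := \sum_i partial i (fun y => F y 0 i) x.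

Definition hessian f x : 'M[R]_n :=
  \matrix_(i, j) partial j (partial i f) x.

Definition C1 f : Prop :=
  (forall x, differentiable f x) /\ continuous (gradient f).

Definition C2 f : Prop := C1 f /\ forall i, C1 (partial i f).

Definition posdefmx (A : 'M[R]_n) : Prop :=
  A^T = A /\ forall v : 'rV[R]_n, v != 0 -> 0 < (v *m A *m v^T) 0 0.

Definition spacelike_weight u x : R :=
  Num.sqrt (1 - enorm (gradient u x) ^+ 2).

Definition classical_solution u : Prop :=
  C2 u /\
  forall x,
    divergence (fun y => (spacelike_weight u y)^-1 *: gradient u y) x
      = (spacelike_weight u x)^-1
    /\ enorm (gradient u x) < 1.

Definition Omega0 u : set 'rV[R]_n := [set x | posdefmx (hessian u x)].

End VectorCalculus.

(* Main.v *)
Require Import Defs.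
From mathcomp Require Import all_boot all_order all_algebra.
From mathcomp Require Import all_classical all_reals all_analysis.
From mathcomp Require Import ring lra.

Set Implicit Arguments.
Unset Strict Implicit.
Unset Printing Implicit Defensive.

Import Order.TTheory GRing.Theory Num.Theory.
Import numFieldNormedType.Exports.

Local Open Scope classical_set_scope.
Local Open Scope ring_scope.

(** Write p for the gradient and A for the Hessian of u, and |.| for the
Euclidean norm. In trace form the equation is
    (1 - |p|^2) tr A + A p . p = 1 - |p|^2,
and the theorem is a strong minimum principle for the least eigenvalue of A.
The classical argument differentiates the equation twice; u being only C^2, the
proof below works with second differences of u instead, and no derivative of
order higher than two ever appears.

If A is definite somewhere but not everywhere, there is a closed ball with
centre y in which A is definite except at one boundary point x0, where
A(x0) e0 . e0 <= 0 for some unit vector e0 ([touching_ball]). Let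
psi(z) = |x0 - y|^2 - |z - y|^2 and phi = psi + K psi^2: close to x0 the
barrier phi has the sign of psi, and its Hessian in the radial direction is
large with K. Near x0, and for k in a cube, minimise
    (u(z + h k) + u(z - h k) - 2 u(z)) / h^2 - eps phi(z) + (|k|^2 - 1)^2.
As h tends to 0 the first term tends to A(z) k . k; the limit functional is
nonpositive at (x0, e0) and, for eps small, positive on the boundary of the
domain, so that for small h the minimum is interior
([exists_interior_min]). The direction k is penalised rather than constrained
to the unit sphere: under a constraint, variations of k would have to be
projected, and the error would involve A(z + h k) - A(z - h k), for which
continuity of A gives no rate.

At the minimum, the first order conditions say that the gradients at
z + h k and z - h k are p + dl + d and p - dl + d, where |dl|^2 and |d| are
O(h^2 eps). Put w^2 = 1 - |p|^2 and test the second order condition on the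
variations (xi, eta) of (z, h k) given by
    (w e_i, - (p . dl / w) e_i) for each i, and (p, dl).
The squares of the xi add up to the coefficients w^2 I + p p^T of the equation
at z, and those of xi + eta and xi - eta to the coefficients at z + h k and
z - h k, up to O(h^2 eps). The equation at the three points therefore makes the
main terms cancel, and what is left is
    8 K w^2 |z - y|^2 h^2 eps <= C h^2 eps,
with C independent of K ([summed_second_variation]). This is impossible when K
is large ([no_degenerate_touching]). *)

(** * Calculus in one variable *)

Section OneVar.
Context {R : realType}.
Implicit Types f g : R -> R.

Lemma is_derive_continuous f (df : R -> R) :
  (forall t : R, is_derive t (1:R) f (df t)) -> continuous f.
Proof.
move=> fd t; apply: differentiable_continuous; apply/derivable1_diffP.
by have := fd t; case.
Qed.

Lemma second_derivative_test f (f1 : R -> R) (c e : R) : 0 < e ->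
  (forall t : R, is_derive t (1:R) f (f1 t)) -> is_derive (0:R) (1:R) f1 c ->
  (forall t, `|t| < e -> f 0 <= f t) -> f1 0 = 0 /\ 0 <= c.
Proof.
move=> e0 fd f1d fmin.
have fc := is_derive_continuous fd.
have f10 : f1 0 = 0.
  have := @derive1_at_min R f (- e) e 0.
  rewrite in_itv/= oppr_lt0 e0 => /(_ _ _ isT) H.
  have {H}: is_derive (0:R) (1:R) f 0.
    apply: H; first by lra.
      by move=> t _; case: (fd t).
    by move=> t; rewrite in_itv/= -ltr_norml; exact: fmin.
  by move=> H; rewrite -(@derive_val _ _ _ _ _ _ _ (fd 0)) (@derive_val _ _ _ _ _ _ _ H).
split => //; rewrite leNgt; apply/negP => c0.
have : \forall t \near (0:R)^', t^-1 *: (f1 (t + 0) - f1 0) < c / 2.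
  case: f1d => d1 d2; have := d1; rewrite /derivable => /cvgr_lt H.
  have H2 : c / 2 > 'D_1 f1 0 by rewrite d2; lra.
  have := H (c/2) H2; apply: filterS => t; rewrite /= /GRing.scale/= !mulr1.
  done.
move=> /nbhs_ballP [r /= r0 hr].
pose m := Num.min e r / 2.
have m0 : 0 < m by rewrite divr_gt0// lt_min e0 r0.
have [me mr] : m < e /\ m < r.
  have : Num.min e r <= e by rewrite ge_min lexx.
  have : Num.min e r <= r by rewrite ge_min lexx orbT.
  by rewrite /m; split; lra.
have [s] := @MVT R f f1 0 m m0 (fun t _ => fd t) (continuous_subspaceT fc).
rewrite in_itv/= => /andP[s0 sm] fE.
have hs : f1 s < 0.
  have := hr s; rewrite /ball/= sub0r normrN gtr0_norm// (lt_trans sm mr) => /(_ isT).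
  have -> : s != 0 by rewrite gt_eqF.
  move=> /(_ isT); rewrite f10 addr0 subr0 /GRing.scale/= => H.
  rewrite -(pmulr_rlt0 _ (_ : 0 < s^-1)) ?invr_gt0//.
  by apply: (lt_trans H); lra.
have : f 0 <= f m by apply: fmin; rewrite gtr0_norm.
rewrite -subr_ge0 fE subr0 leNgt => /negP; apply.
by rewrite nmulr_rlt0.
Qed.

(** Rolle's theorem, applied twice to the second difference minus the
multiple of t^2 that has the same value at 1. *)
Lemma second_difference_mean f (f1 f2 : R -> R) :
  (forall t : R, is_derive t (1:R) f (f1 t)) ->
  (forall t : R, is_derive t (1:R) f1 (f2 t)) ->
  exists2 s : R, 0 < s < 1 & f 1 + f (-1) - 2 * f 0 = (f2 s + f2 (- s)) / 2.
Proof.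
move=> d1 d2.
pose G t := f t + f (- t) - 2 * f 0.
pose c := G 1.
have dn (g g1 : R -> R) (t : R) : (forall t : R, is_derive t (1:R) g (g1 t)) ->
    is_derive t (1:R) (fun t => g (- t)) (- g1 (- t)).
  move=> dg; have H := @is_derive1_comp R g (fun t => - t) t _ _ (dg (- t)) (is_deriveNid t 1).
  by move: H; rewrite mulrN1.
have dG t : is_derive t (1:R) (fun t => G t - c * t ^+ 2) (f1 t - f1 (- t) - 2 * c * t).
  have H1 := d1 t; have H2 := dn _ _ t d1.
  apply: is_derive_eq; rewrite /GRing.scale/=; ring.
have dG1 t : is_derive t (1:R) (fun t => f1 t - f1 (- t) - 2 * c * t) (f2 t + f2 (- t) - 2 * c).
  have H1 := d2 t; have H2 := dn _ _ t d2.
  apply: is_derive_eq; rewrite /GRing.scale/=; ring.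
have [|||s] := @Rolle R (fun t => G t - c * t ^+ 2) 0 1 ltr01.
- by move=> t _; case: (dG t).
- exact: continuous_subspaceT (is_derive_continuous dG).
- rewrite /c /G oppr0; ring.
rewrite in_itv/= => /andP[s0 s1] ds.
have e1 : f1 s - f1 (- s) - 2 * c * s = 0.
  by move: ds (dG s) => [_ <-] [_ <-].
have [|||q] := @Rolle R (fun t => f1 t - f1 (- t) - 2 * c * t) 0 s s0.
- by move=> t _; case: (dG1 t).
- exact: continuous_subspaceT (is_derive_continuous dG1).
- rewrite e1 oppr0; ring.
rewrite in_itv/= => /andP[q0 q1] dq.
have e2 : f2 q + f2 (- q) - 2 * c = 0.
  by move: dq (dG1 q) => [_ <-] [_ <-].
exists q; first by rewrite q0 (lt_trans q1).
move: e2; rewrite /c /G; lra.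
Qed.
End OneVar.

(** * Euclidean forms and derivatives along lines *)

Section Vectors.
Context {R : realType} {n : nat}.
Implicit Types (v w x y : 'rV[R]_n) (A : 'M[R]_n).

Definition dot v w : R := (v *m w^T) 0 0.
(** The quadratic form in [posdefmx], as a bilinear form. *)
Definition bil A v w : R := dot (v *m A) w.

Lemma dotE v w : dot v w = \sum_i v 0 i * w 0 i.
Proof. by rewrite /dot mxE; apply: eq_bigr => i _; rewrite mxE. Qed.

Lemma dotC v w : dot v w = dot w v.
Proof. by rewrite !dotE; apply: eq_bigr => i _; rewrite mulrC. Qed.

Lemma dotDl v w y : dot (v + w) y = dot v y + dot w y.
Proof. by rewrite /dot mulmxDl mxE. Qed.
Lemma dotDr v w y : dot y (v + w) = dot y v + dot y w.
Proof. by rewrite dotC dotDl !(dotC y). Qed.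
Lemma dotZl a v w : dot (a *: v) w = a * dot v w.
Proof. by rewrite /dot -scalemxAl mxE. Qed.
Lemma dotZr a v w : dot v (a *: w) = a * dot v w.
Proof. by rewrite dotC dotZl dotC. Qed.
Lemma dotNl v w : dot (- v) w = - dot v w.
Proof. by rewrite -scaleN1r dotZl mulN1r. Qed.
Lemma dotNr v w : dot v (- w) = - dot v w.
Proof. by rewrite dotC dotNl dotC. Qed.

Lemma bilDl A v w y : bil A (v + w) y = bil A v y + bil A w y.
Proof. by rewrite /bil mulmxDl dotDl. Qed.
Lemma bilDr A v w y : bil A y (v + w) = bil A y v + bil A y w.
Proof. by rewrite /bil dotDr. Qed.
Lemma bilZl A a v w : bil A (a *: v) w = a * bil A v w.
Proof. by rewrite /bil -scalemxAl dotZl. Qed.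
Lemma bilZr A a v w : bil A v (a *: w) = a * bil A v w.
Proof. by rewrite /bil dotZr. Qed.
Lemma bilNl A v w : bil A (- v) w = - bil A v w.
Proof. by rewrite -scaleN1r bilZl mulN1r. Qed.
Lemma bilNr A v w : bil A v (- w) = - bil A v w.
Proof. by rewrite /bil dotNr. Qed.

Lemma bilE A v w : bil A v w = \sum_j (\sum_i v 0 i * A i j) * w 0 j.
Proof. by rewrite /bil dotE; apply: eq_bigr => i _; rewrite mxE. Qed.

Lemma dot_delta v i : dot v (delta_mx 0 i) = v 0 i.
Proof.
rewrite dotE (bigD1 i)//= mxE !eqxx mulr1 big1 ?addr0// => j ji.
by rewrite mxE (negbTE ji) andbF mulr0.
Qed.

Lemma bil_delta A i j : bil A (delta_mx 0 i) (delta_mx 0 j) = A i j.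
Proof. by rewrite /bil dot_delta -rowE mxE. Qed.

Lemma sum_bil_delta A v : \sum_i v 0 i * bil A v (delta_mx 0 i) = bil A v v.
Proof.
rewrite [RHS]bilE; apply: eq_bigr => i _.
by rewrite mulrC /bil dot_delta mxE.
Qed.

Lemma dot_ge0 v : 0 <= dot v v.
Proof. by rewrite dotE sumr_ge0// => i _; rewrite -expr2 sqr_ge0. Qed.

Lemma dot_eq0 v : dot v v = 0 -> v = 0.
Proof.
rewrite dotE => /eqP; rewrite psumr_eq0 => [/allP H|i _]; last by rewrite -expr2 sqr_ge0.
apply/rowP => i; rewrite mxE; apply/eqP.
by have := H i (mem_index_enum i); rewrite /= -expr2 sqrf_eq0.
Qed.

Lemma coord_le_norm v i : `|v 0 i| <= `|v|.
Proof.
rewrite [leRHS]/Num.norm/= mx_normrE; apply/bigmax_geP; right => /=.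
by exists (0, i).
Qed.

Lemma coord_sqr_le_dot v i : v 0 i ^+ 2 <= dot v v.
Proof.
rewrite dotE (bigD1 i)//= expr2 lerDl sumr_ge0// => j _.
by rewrite -expr2 sqr_ge0.
Qed.

(** Together with [dot_le_norm], this compares the sup norm `|v| with the
Euclidean norm. *)
Lemma norm_le_dot v c : 0 <= c -> dot v v <= c ^+ 2 -> `|v| <= c.
Proof.
move=> c0 H; rewrite [leLHS]/Num.norm/= mx_normrE; apply/bigmax_leP; split=> //=.
move=> [i j] _ /=; rewrite ord1 -(@ler_pXn2r _ 2)//= ?nnegrE//.
by rewrite real_normK ?num_real// (le_trans (coord_sqr_le_dot v j)).
Qed.

Lemma dot_le_norm v w : `|dot v w| <= n%:R * (`|v| * `|w|).
Proof.
rewrite dotE (le_trans (ler_norm_sum _ _ _))//.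
have -> : n%:R * (`|v| * `|w|) = \sum_(i < n) (`|v| * `|w|).
  by rewrite sumr_const card_ord mulr_natl.
by apply: ler_sum => i _; rewrite normrM ler_pM// coord_le_norm.
Qed.

Lemma bil_le_norm A c v w : 0 <= c -> (forall i j, `|A i j| <= c) ->
  `|bil A v w| <= n%:R ^+ 2 * c * (`|v| * `|w|).
Proof.
move=> c0 Ac; have H : `|v *m A| <= n%:R * (`|v| * c).
  rewrite [leLHS]/Num.norm/= mx_normrE; apply/bigmax_leP; split=> /=.
    by rewrite !mulr_ge0.
  move=> [i j] _ /=; rewrite ord1 mxE (le_trans (ler_norm_sum _ _ _))//.
  have -> : n%:R * (`|v| * c) = \sum_(i < n) (`|v| * c).
    by rewrite sumr_const card_ord mulr_natl.
  by apply: ler_sum => k _; rewrite normrM ler_pM// coord_le_norm.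
rewrite /bil (le_trans (dot_le_norm _ _))//.
have -> : n%:R ^+ 2 * c * (`|v| * `|w|) = n%:R * ((n%:R * (`|v| * c)) * `|w|) by ring.
by rewrite ler_wpM2l// ler_wpM2r.
Qed.

Lemma trace_le A c : (forall i j, `|A i j| <= c) -> `|\tr A| <= n%:R * c.
Proof.
move=> Ac; rewrite /mxtrace (le_trans (ler_norm_sum _ _ _))//.
have -> : n%:R * c = \sum_(i < n) c by rewrite sumr_const card_ord mulr_natl.
exact: ler_sum.
Qed.

Lemma enorm_sqr v : enorm v ^+ 2 = dot v v.
Proof.
have e : \sum_i v 0 i ^+ 2 = dot v v.
  by rewrite dotE; apply: eq_bigr => i _; rewrite expr2.
by rewrite /enorm e sqr_sqrtr// dot_ge0.
Qed.

End Vectors.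

Section Lines.
Context {R : realType} {n : nat}.
Implicit Types (v w x y : 'rV[R]_n) (A : 'M[R]_n) (f u : 'rV[R]_n -> R).

Lemma is_derive_line f x v (t : R) : (forall y, differentiable f y) ->
  is_derive t (1:R) (fun t => f (x + t *: v)) ('D_v f (x + t *: v)).
Proof.
move=> fd.
have E : (fun h : R => h^-1 *: ((f (x + (h *: (1:R) + t) *: v)) - f (x + t *: v)))
  = (fun h : R => h^-1 *: (f (h *: v + (x + t *: v)) - f (x + t *: v))).
  apply/funext => h; congr (_ *: (f _ - _)).
  by rewrite [h *: (1:R)]mulr1 scalerDl addrCA.
apply: DeriveDef.
  by rewrite /derivable /= E; apply: diff_derivable.
by rewrite /derive /= E.
Qed.

Lemma derive_dot f x v : differentiable f x -> 'D_v f x = dot v (gradient f x).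
Proof.
move=> fd; rewrite deriveE// [v in LHS]row_sum_delta linear_sum dotE.
apply: eq_bigr => i _; rewrite linearZ /= mxE /partial deriveE//.
Qed.

Lemma line_derive f x v (t : R) : C1 f ->
  is_derive t (1:R) (fun t => f (x + t *: v)) (dot v (gradient f (x + t *: v))).
Proof. by move=> [fd _]; rewrite -derive_dot//; exact: is_derive_line. Qed.

(** The Hessian carries the direction of differentiation in its second index,
hence the order of the last two arguments of [bil]. *)
Lemma line_derive2 u x v w (t : R) : C2 u ->
  is_derive t (1:R) (fun t => dot w (gradient u (x + t *: v)))
    (bil (hessian u (x + t *: v)) w v).
Proof.
move=> [_ uc].
have -> : (fun t : R => dot w (gradient u (x + t *: v)))
  = \sum_i (fun t => w 0 i * partial i u (x + t *: v)).
  apply/funext => s; rewrite fct_sumE dotE; apply: eq_bigr => i _.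
  by rewrite mxE.
have -> : bil (hessian u (x + t *: v)) w v =
  \sum_i w 0 i * dot v (gradient (partial i u) (x + t *: v)).
  rewrite bilE; under eq_bigr do rewrite mulr_suml.
  rewrite exchange_big /=; apply: eq_bigr => i _.
  rewrite dotE mulr_sumr; apply: eq_bigr => j _; rewrite !mxE; ring.
apply: is_derive_sum => i.
have H := line_derive x v t (uc i).
exact: (@is_deriveZ _ _ _ _ (w 0 i) _ _ _ H).
Qed.

End Lines.

(** * Symmetry of the Hessian and the equation in trace form *)

Section Second.
Context {R : realType} {n : nat}.
Implicit Types (v w x y a b : 'rV[R]_n) (A : 'M[R]_n) (f u : 'rV[R]_n -> R).

Lemma gradient_continuous u : C2 u -> continuous (gradient u).
Proof. by move=> [[_ ]]. Qed.

Lemma hessian_continuous u i j : C2 u -> continuous (fun x => hessian u x i j).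
Proof.
move=> [_ /(_ i)[_ H]].
have -> : (fun x => hessian u x i j) = (fun g : 'rV[R]_n => g 0 j) \o gradient (partial i u).
  by apply/funext => x; rewrite /= !mxE.
by move=> x; apply: continuous_comp; [exact: H|exact: coord_continuous].
Qed.

(** The mean value theorem, once in each direction. Exchanging a and b leaves
the left-hand side unchanged, which is how symmetry of the Hessian follows. *)
Lemma mixed_difference_mean u x a b (h : R) : C2 u -> 0 < h ->
  exists2 y, `|y - x| <= h * (`|a| + `|b|) &
  u (x + h *: a + h *: b) - u (x + h *: a) - u (x + h *: b) + u x
    = h ^+ 2 * bil (hessian u y) a b.
Proof.
move=> uC h0; have [uC1 _] := uC.
pose F t := u (x + h *: b + t *: a) - u (x + t *: a).
pose F1 t := dot a (gradient u (x + h *: b + t *: a)) - dot a (gradient u (x + t *: a)).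
have dF t : is_derive t (1:R) F (F1 t).
  by have H1 := line_derive (x + h *: b) a t uC1; have H2 := line_derive x a t uC1;
    apply: is_deriveB.
have [s] := @MVT R F F1 0 h h0 (fun t _ => dF t) (continuous_subspaceT (is_derive_continuous dF)).
rewrite in_itv/= => /andP[s0 sh] e1.
pose G t := dot a (gradient u (x + s *: a + t *: b)).
pose G1 t := bil (hessian u (x + s *: a + t *: b)) a b.
have dG t : is_derive t (1:R) G (G1 t) by exact: line_derive2.
have [r] := @MVT R G G1 0 h h0 (fun t _ => dG t) (continuous_subspaceT (is_derive_continuous dG)).
rewrite in_itv/= => /andP[r0 rh] e2.
exists (x + s *: a + r *: b).
  have -> : x + s *: a + r *: b - x = s *: a + r *: b by rewrite -(addrA x) [LHS]addrC addKr.
  rewrite mulrDr (le_trans (ler_normD _ _))//.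
  by rewrite !normrZ (gtr0_norm s0) (gtr0_norm r0) lerD// ler_wpM2r// ltW.
have e3 : F1 s = G h - G 0.
  by rewrite /F1 /G scale0r addr0 addrAC.
move: e1; rewrite e3 e2 /F !scale0r !addr0 !subr0 (addrAC x) => e1.
have -> : h ^+ 2 * bil (hessian u (x + s *: a + r *: b)) a b = G1 r * h * h.
  by rewrite /G1; ring.
by rewrite -e1; ring.
Qed.

Lemma hessian_sym u x : C2 u -> (hessian u x)^T = hessian u x.
Proof.
move=> uC; apply/matrixP => j i; rewrite mxE; apply/eqP/negPn/negP.
have mix y a b h := @mixed_difference_mean u y a b h uC.
have Hc k l := @hessian_continuous u k l uC.
move: (hessian u) mix Hc => H mix Hc neq.
pose e := `|H x i j - H x j i| / 2.
have e0 : 0 < e by rewrite divr_gt0// normr_gt0 subr_eq0.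
have near_hess k l : exists2 r, 0 < r & forall y, `|y - x| < r ->
    `|H x k l - H y k l| < e.
  have /cvgrPdist_lt /(_ e e0) /nbhs_ballP[r /= r0 Hr] := Hc k l x.
  exists r => // y yx; apply: Hr; by rewrite -ball_normE /= distrC.
have [r1 r10 H1] := near_hess i j; have [r2 r20 H2] := near_hess j i.
pose a : 'rV[R]_n := delta_mx 0 i; pose b : 'rV[R]_n := delta_mx 0 j.
pose m := Num.min r1 r2; pose h := m / 2 / (`|a| + `|b| + 1).
have m0 : 0 < m by rewrite lt_min r10 r20.
have N0 : 0 < `|a| + `|b| + 1 by rewrite ltr_wpDl// addr_ge0.
have h0 : 0 < h by rewrite !divr_gt0.
have hm : h * (`|a| + `|b|) < m.
  have : h * (`|a| + `|b| + 1) = m / 2 by rewrite /h divfK// gt_eqF.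
  rewrite mulrDr; lra.
have [mr1 mr2] : m <= r1 /\ m <= r2 by rewrite !ge_min !lexx orbT.
have [y yx ey] := mix x a b _ h0.
have [z zx ez] := mix x b a _ h0.
have : bil (H y) a b = bil (H z) b a.
  have : h ^+ 2 * bil (H y) a b = h ^+ 2 * bil (H z) b a.
    rewrite -ey -ez (addrAC x (h *: b)).
    by move: (u _) (u _) (u _) (u _) => *; ring.
  by apply: mulfI; rewrite expf_neq0// gt_eqF.
rewrite /a /b !bil_delta => eyz.
have {}H1 : `|H x i j - H y i j| < e by apply/H1/(le_lt_trans yx)/(lt_le_trans hm).
have {}H2 : `|H x j i - H z j i| < e.
  by apply/H2/(le_lt_trans zx); rewrite addrC; apply/(lt_le_trans hm).
have : `|H x i j - H x j i| < e + e.
  have -> : H x i j - H x j i = (H x i j - H y i j) - (H x j i - H z j i).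
    by rewrite eyz; ring.
  by rewrite (le_lt_trans (ler_normB _ _))// ltrD.
by rewrite /e; lra.
Qed.

Lemma derive_lineE f x v : 'D_v f x = 'D_(1:R) (fun t : R => f (x + t *: v)) (0:R).
Proof.
rewrite /derive.
suff -> : (fun h : R => h^-1 *: ((f \o shift x) (h *: v) - f x)) =
  (fun h : R => h^-1 *: (((fun t => f (x + t *: v)) \o shift 0) (h *: (1:R)) - f (x + 0 *: v))) by [].
apply/funext => h; rewrite /= scale0r !addr0 [h *: (1:R)]mulr1.
by rewrite (addrC x).
Qed.

(** Expanding the divergence gives W^-1 tr A + W^-3 A p . p = W^-1 with
W^2 = 1 - |p|^2. *)
Lemma solution_nondivergence u x : classical_solution u ->
  let p := gradient u x in
  dot p p < 1 /\
  (1 - dot p p) * \tr (hessian u x) + bil (hessian u x) p p = 1 - dot p p.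
Proof.
move=> [uC sol] p; have [pde len] := sol x.
have pp y : enorm (gradient u y) ^+ 2 = dot (gradient u y) (gradient u y) by exact: enorm_sqr.
have plt1 y : dot (gradient u y) (gradient u y) < 1.
  have [_ leny] := sol y; rewrite -pp expr2.
  have e0 : 0 <= enorm (gradient u y) by rewrite sqrtr_ge0.
  nra.
split; first exact: plt1.
pose W := spacelike_weight u x.
have W0 : 0 < W by rewrite sqrtr_gt0 subr_gt0 pp plt1.
have W2 : W ^+ 2 = 1 - dot p p by rewrite sqr_sqrtr pp// subr_ge0 ltW.
set A := hessian u x in pde *.
suff part i : partial i (fun y => ((spacelike_weight u y)^-1 *: gradient u y) 0 i) x
    = W^-1 * A i i + W^-1 ^+ 3 * (p 0 i * bil A p (delta_mx 0 i)).
  move: pde; rewrite /divergence (eq_bigr _ (fun i _ => part i)) big_split/=.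
  rewrite -!mulr_sumr sum_bil_delta -/(mxtrace A) -/W -W2 => E.
  have Wn0 : W != 0 by rewrite gt_eqF.
  move: E; move: (\tr A) (bil A p p) => T B E.
  have -> : W ^+ 2 * T + B = W ^+ 3 * (W^-1 * T + W^-1 ^+ 3 * B) by field.
  by rewrite E; field.
set e : 'rV[R]_n := delta_mx 0 i.
have q0E : x + 0 *: e = x by rewrite scale0r addr0.
pose q (t : R) := 1 - dot (gradient u (x + t *: e)) (gradient u (x + t *: e)).
have dq : is_derive (0:R) (1:R) q (- (2 * bil A p e)).
  have -> : q = cst 1 - \sum_k (fun t : R => (partial k u (x + t *: e)) ^+ 2).
    apply/funext => t; rewrite /q dotE fct_sumE; congr (_ - _).
    by apply: eq_bigr => k _; rewrite !mxE expr2.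
  have -> : - (2 * bil A p e) = 0 - \sum_k (2 * partial k u x * partial i (partial k u) x).
    rewrite sub0r /bil dot_delta mxE mulr_sumr; congr (- _).
    by apply: eq_bigr => k _; rewrite !mxE mulrA.
  apply: is_deriveB; apply: is_derive_sum => k.
  have [_ /(_ k) uk] := uC.
  have H := line_derive x e 0 uk.
  apply: is_derive_eq; rewrite q0E dotC dot_delta !mxE /GRing.scale/=; ring.
have q0 : 0 < q 0 by rewrite /q q0E subr_gt0 plt1.
have qW : Num.sqrt (q 0) = W by rewrite /W /spacelike_weight pp /q q0E.
have dsq : is_derive (0:R) (1:R) (Num.sqrt \o q) ((2 * W)^-1 * - (2 * bil A p e)).
  by apply: is_derive1_comp; rewrite -qW; exact: is_derive1_sqrt.
have dV : is_derive (0:R) (1:R) (fun t => ((Num.sqrt \o q) t)^-1) (- W ^- 2 * ((2 * W)^-1 * - (2 * bil A p e))).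
  case: dsq => d1 d2; have nz : (Num.sqrt \o q) 0 != 0 by rewrite /= qW gt_eqF.
  apply: DeriveDef; first exact: derivableV.
  by rewrite deriveV// d2 /= qW.
have dg : is_derive (0:R) (1:R) (fun t => partial i u (x + t *: e)) (A i i).
  have [_ /(_ i) ui] := uC.
  by have := line_derive x e 0 ui; rewrite q0E dotC dot_delta !mxE.
have dM := is_deriveM dV dg.
rewrite /partial derive_lineE.
have -> : (fun t : R => ((spacelike_weight u (x + t *: e))^-1 *: gradient u (x + t *: e)) 0 i)
  = (fun t => ((Num.sqrt \o q) t)^-1) * (fun t => partial i u (x + t *: e)).
  by apply/funext => t; rewrite !mxE /spacelike_weight pp.
rewrite derive_val /= qW q0E /GRing.scale/= /p !mxE -/e.
have Wn0 : W != 0 by rewrite gt_eqF.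
by field.
Qed.

End Second.

(** * Continuity and compactness *)

Section Continuity.
Context {R : realType} {n : nat} {T : topologicalType}.
Implicit Types (f g : T -> R) (F G : T -> 'rV[R]_n).

Lemma cont_sum (I : finType) (h : I -> T -> R) :
  (forall i, continuous (h i)) -> continuous (fun q => \sum_i h i q).
Proof.
move=> hc.
have -> : (fun q => \sum_i h i q) = \sum_i h i by rewrite fct_sumE.
elim/big_ind : _ => [x|f g fc gc x|i _]; first exact: cvg_cst.
- by apply: cvgD; [exact: fc|exact: gc].
- exact: hc.
Qed.

Lemma cont_coord F i : continuous F -> continuous (fun q => F q 0 i).
Proof.
move=> Fc q.
exact: (@continuous_comp _ _ _ F (fun v : 'rV[R]_n => v 0 i) q (Fc q)
  (@coord_continuous _ _ _ 0 i _)).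
Qed.

Lemma cont_dot F G : continuous F -> continuous G ->
  continuous (fun q => dot (F q) (G q)).
Proof.
move=> Fc Gc.
have -> : (fun q => dot (F q) (G q)) = (fun q => \sum_i F q 0 i * G q 0 i).
  by apply/funext => q; rewrite dotE.
apply: cont_sum => i q; apply: cvgM.
  exact: cont_coord.
exact: cont_coord.
Qed.

Lemma cont_bil (A : T -> 'M[R]_n) F G : (forall i j, continuous (fun q => A q i j)) ->
  continuous F -> continuous G -> continuous (fun q => bil (A q) (F q) (G q)).
Proof.
move=> Ac Fc Gc.
have -> : (fun q => bil (A q) (F q) (G q)) =
   (fun q => \sum_j (\sum_i F q 0 i * A q i j) * G q 0 j).
  by apply/funext => q; rewrite bilE.
apply: cont_sum => i q; apply: cvgM; last first.
  exact: cont_coord.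
apply: cont_sum => j q'; apply: cvgM; last exact: Ac.
exact: cont_coord.
Qed.

Lemma closed_sublevel f c : continuous f -> closed [set q | f q <= c].
Proof.
move=> fc; apply: (@closed_comp _ _ f [set x | x <= c]); last exact: closed_le.
by move=> x _; exact: fc.
Qed.

Lemma closed_superlevel f c : continuous f -> closed [set q | c <= f q].
Proof.
move=> fc; apply: (@closed_comp _ _ f [set x | c <= x]); last exact: closed_ge.
by move=> x _; exact: fc.
Qed.

End Continuity.

Section Compactness.
Context {R : realType} {n : nat}.
Local Notation E := 'rV[R]_n.

Lemma compact_closed_bounded (A : set (E * E)) (M : R) : closed A ->
  (forall q, A q -> `|q.1| <= M /\ `|q.2| <= M) -> compact A.
Proof.
move=> Acl Ab.
have bc : compact [set v : E | `|v| <= M].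
  apply: bounded_closed_compact; last first.
    by apply: closed_sublevel; exact: norm_continuous.
  by exists M; split; [exact: num_real|move=> y My v /= vM; rewrite (le_trans vM)// ltW].
apply: (subclosed_compact Acl (compact_setX bc bc)) => q Aq.
by have [] := Ab q Aq.
Qed.

Lemma exists_min (A : set (E * E)) (f : E * E -> R) : compact A -> A !=set0 ->
  continuous f -> exists2 q, A q & forall q', A q' -> f q <= f q'.
Proof.
move=> Ac A0 fc.
have [q qA qmin] := compact_EVT_min A0 Ac (continuous_subspaceT fc).
by exists q => [|q' q'A]; [rewrite inE in qA|apply: qmin; rewrite inE].
Qed.

(** The empty set is allowed, since the set of boundary points in the ball may
be empty. *)
Lemma positive_lower_bound (A : set (E * E)) (f : E * E -> R) : compact A ->
  continuous f -> (forall q, A q -> 0 < f q) ->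
  exists2 c, 0 < c & forall q, A q -> c <= f q.
Proof.
move=> Ac fc fpos; have [A0|A0] := pselect (A !=set0).
  have [q Aq qmin] := exists_min Ac A0 fc.
  by exists (f q); [exact: fpos|exact: qmin].
by exists 1 => // q Aq; exfalso; apply: A0; exists q.
Qed.

Lemma compact_bounded_above (A : set (E * E)) (f : E * E -> R) : compact A ->
  continuous f -> exists2 c, 0 < c & forall q, A q -> f q <= c.
Proof.
move=> Ac fc; have [A0|A0] := pselect (A !=set0).
  have [|q Aq qmin] := exists_min Ac A0 (_ : continuous (fun q => - f q)).
    by move=> q; apply: cvgN; exact: fc.
  exists (Num.max (f q) 1) => [|q' Aq']; first by rewrite lt_max ltr01 orbT.
  by rewrite le_max -(lerN2 (f q)) qmin.
by exists 1 => // q Aq; exfalso; apply: A0; exists q.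
Qed.

(** The Heine-Cantor argument, in the form needed to replace second differences
by second derivatives uniformly on a compact set. *)
Lemma uniform_small (A : set (E * E)) (G : E * (E * E) -> R) (e : R) : 0 < e ->
  compact A -> continuous G -> (forall q, A q -> G (0, q) = 0) ->
  exists2 r, 0 < r & forall z q, `|z| < r -> A q -> `|G (z, q)| < e.
Proof.
move=> e0 /compact_near_coveringP/(_ E (nbhs (0:E)) (fun z q => `|G (z, q)| < e)) H Gc G0.
have /nbhs_ballP[r /= r0 rH] : \forall z \near (0:E), A `<=` (fun q => `|G (z, q)| < e).
  apply: H => q Aq.
  have H2 : \forall p \near ((0:E), q), `|G p| < e.
    have /cvgrPdist_lt/(_ _ e0) := Gc (0, q).
    by apply: filterS => p; rewrite G0// sub0r normrN.
  case: H2 => [[U V] [/= U0 Vq] UV].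
  by exists (V, U) => // -[q' z] [/= Vq' Uz]; exact: (UV (z, q')).
exists r => // z q zr Aq; apply: (rH z) => //.
by rewrite -ball_normE /= sub0r normrN.
Qed.

End Compactness.

(** * A ball of definiteness touching a degenerate point, and second variations *)

Section TouchingBall.
Context {R : realType} {n : nat}.
Local Notation E := 'rV[R]_n.
Context (H : E -> 'M[R]_n) (Hc : forall i j, continuous (fun x => H x i j)).

Definition posbil (A : 'M[R]_n) := forall v : E, v != 0 -> 0 < bil A v v.

Lemma cont_subr_cst (T : topologicalType) (F : T -> E) (c : E) :
  continuous F -> continuous (fun q => F q - c).
Proof. by move=> Fc q; apply: cvgB; [exact: Fc|exact: cvg_cst]. Qed.

Lemma cont_entry_fst i j : continuous (fun q : E * E => H q.1 i j).
Proof.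
move=> q.
have fc : {for q, continuous (@fst E E)} by exact: cvg_fst.
exact: (continuous_comp fc (@Hc i j q.1)).
Qed.

Lemma cont_bil_pair : continuous (fun q : E * E => bil (H q.1) q.2 q.2).
Proof.
apply: cont_bil; first exact: cont_entry_fst.
- by move=> q; exact: cvg_snd.
- by move=> q; exact: cvg_snd.
Qed.

Lemma not_posbil (A : 'M[R]_n) : ~ posbil A -> exists2 v, dot v v = 1 & bil A v v <= 0.
Proof.
move=> /existsNP[v /not_implyP[v0 /negP]]; rewrite -leNgt => vA.
have d0 : 0 < dot v v.
  rewrite lt_neqAle dot_ge0 andbT eq_sym; apply: contraNN v0 => /eqP/dot_eq0 ->//.
exists ((Num.sqrt (dot v v))^-1 *: v).
  rewrite dotZl dotZr mulrA -invfM -expr2 sqr_sqrtr ?dot_ge0//.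
  by rewrite mulVf// gt_eqF.
by rewrite bilZl bilZr mulrA -expr2 mulr_ge0_le0// sqr_ge0.
Qed.

Lemma dot_sub_eq0 (x y : E) : dot (x - y) (x - y) <= 0 -> x = y.
Proof.
move=> h; apply/eqP; rewrite -subr_eq0; apply/eqP/dot_eq0/eqP.
by rewrite eq_le h dot_ge0.
Qed.

(** Take the point x0 closest to y0 at which some unit vector e0 makes the form
nonpositive; it exists by compactness of the set of such pairs. The ball whose
diameter is the segment from y0 to x0 lies in the open ball with centre y0
through x0, apart from x0 itself. *)
Lemma touching_ball y0 x1 : posbil (H y0) -> ~ posbil (H x1) ->
  exists x0 e0 y : E, [/\ 0 < dot (x0 - y) (x0 - y), dot e0 e0 = 1,
    bil (H x0) e0 e0 <= 0 &
    forall z, dot (z - y) (z - y) <= dot (x0 - y) (x0 - y) -> z != x0 -> posbil (H z)].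
Proof.
move=> y0pos /not_posbil[e1 e11 He1].
pose d1 := dot (x1 - y0) (x1 - y0).
have d10 : 0 <= d1 by exact: dot_ge0.
pose dist (q : E * E) := dot (q.1 - y0) (q.1 - y0).
have distc : continuous dist.
  by apply: cont_dot; apply: cont_subr_cst => q; exact: cvg_fst.
have vvc : continuous (fun q : E * E => dot q.2 q.2).
  by apply: cont_dot => q; exact: cvg_snd.
pose A : set (E * E) := [set q | dist q <= d1] `&` ([set q | dot q.2 q.2 <= 1] `&`
  ([set q | 1 <= dot q.2 q.2] `&` [set q | bil (H q.1) q.2 q.2 <= 0])).
have Acl : closed A.
  apply: closedI; first exact: closed_sublevel.
  apply: closedI; first exact: closed_sublevel.
  apply: closedI; first exact: closed_superlevel.
  apply: closed_sublevel; exact: cont_bil_pair.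
have Ac : compact A.
  apply: (@compact_closed_bounded _ _ A (d1 + 1 + `|y0|)) => // -[x v] [/= h1 [h2 _]]; split.
    have : `|x - y0| <= d1 + 1 by apply: norm_le_dot; [lra|apply: (le_trans h1); nra].
    move=> h; rewrite -[x](subrK y0) (le_trans (ler_normD _ _))//; lra.
  have : `|v| <= 1 by apply: norm_le_dot; rewrite ?expr1n.
  have := normr_ge0 y0; lra.
have A1 : A (x1, e1) by split => /=; rewrite ?e11.
have [[x0 e0] [/= a1 [a2 [a3 a4]]] amin] := exists_min Ac (ex_intro _ _ A1) distc.
have e01 : dot e0 e0 = 1 by apply/eqP; rewrite eq_le a2 a3.
have x0y0 : x0 != y0.
  apply/eqP => x0y0; move: a4; rewrite x0y0 leNgt => /negP; apply; apply: y0pos.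
  by apply/eqP => e00; move: a3; rewrite e00 /dot mul0mx mxE ler10.
pose b := 2^-1 *: (x0 - y0).
have b0 : 0 < dot b b.
  rewrite lt_neqAle dot_ge0 andbT eq_sym; apply/eqP => /dot_eq0 /eqP.
  by rewrite scaler_eq0 invr_eq0 pnatr_eq0 /= subr_eq0 (negbTE x0y0).
have bE : x0 - y0 = b + b by rewrite -mulr2n -scaler_nat scalerA divff ?pnatr_eq0// scale1r.
exists x0, e0, (y0 + b).
have xb : x0 - (y0 + b) = b by rewrite opprD addrA bE addrK.
split => //; first by rewrite xb.
move=> z; rewrite xb => zb zx0; apply: contrapT => /not_posbil[v v1 vH].
(* A degenerate z may also be too far away to belong to A. *)
have far : dist (x0, e0) <= dist (z, v).
  have [zd|zd] := leP (dist (z, v)) d1.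
    by apply: amin; split => //; split; rewrite /= ?v1.
  by apply: (le_trans a1); exact: ltW.
move/negP: zx0; apply; apply/eqP/dot_sub_eq0.
set a := z - (y0 + b) in zb.
have e3 : z - y0 = a + b by rewrite /a opprD addrA subrK.
have -> : z - x0 = a - b.
  by rewrite -(subrK y0 z) -(subrK y0 x0) e3 bE opprD addrACA subrr addr0 opprD addrA addrK.
clearbody a b; move: far; rewrite /dist /= e3 bE !(dotDl, dotDr, dotNl, dotNr). rewrite (dotC b a).
lra.
Qed.

End TouchingBall.

Section SecondVariation.
Context {R : realType} {n : nat}.
Local Notation E := 'rV[R]_n.
Implicit Types (u : E -> R).

Lemma combined_second_derivative_test (a b c P a1 b1 c1 P1 : R -> R) (a2 b2 c2 P2 e : R) :
  0 < e ->
  (forall t : R, is_derive t (1:R) a (a1 t)) -> is_derive (0:R) (1:R) a1 a2 ->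
  (forall t : R, is_derive t (1:R) b (b1 t)) -> is_derive (0:R) (1:R) b1 b2 ->
  (forall t : R, is_derive t (1:R) c (c1 t)) -> is_derive (0:R) (1:R) c1 c2 ->
  (forall t : R, is_derive t (1:R) P (P1 t)) -> is_derive (0:R) (1:R) P1 P2 ->
  (forall t, `|t| < e -> a 0 + b 0 - 2 * c 0 + P 0 <= a t + b t - 2 * c t + P t) ->
  a1 0 + b1 0 - 2 * c1 0 + P1 0 = 0 /\ 0 <= a2 + b2 - 2 * c2 + P2.
Proof.
move=> e0 da da1 db db1 dc dc1 dP dP1 umin.
have dF t : is_derive t (1:R) (fun t => a t + b t - 2 * c t + P t)
    (a1 t + b1 t - 2 * c1 t + P1 t).
  have h1 := da t; have h2 := db t; have h3 := dc t; have h4 := dP t.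
  apply: is_derive_eq; rewrite /GRing.scale/=; ring.
have dF1 : is_derive (0:R) (1:R) (fun t => a1 t + b1 t - 2 * c1 t + P1 t)
    (a2 + b2 - 2 * c2 + P2).
  apply: is_derive_eq; rewrite /GRing.scale/=; ring.
exact: (second_derivative_test e0 dF dF1 umin).
Qed.

(** First and second order conditions for the second difference of u plus a
one-variable perturbation P. The points x and y, which are z + h k and z - h k
in the application, move with velocities xi + eta and xi - eta. *)
Lemma second_variation u (x y z xi eta : E) (P P1 : R -> R) (P2 e : R) :
  C2 u -> 0 < e ->
  (forall t : R, is_derive t (1:R) P (P1 t)) -> is_derive (0:R) (1:R) P1 P2 ->
  (forall t, `|t| < e -> u x + u y - 2 * u z + P 0 <=
     u (x + t *: (xi + eta)) + u (y + t *: (xi - eta)) - 2 * u (z + t *: xi) + P t) ->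
  dot (xi + eta) (gradient u x) + dot (xi - eta) (gradient u y)
    - 2 * dot xi (gradient u z) + P1 0 = 0 /\
  0 <= bil (hessian u x) (xi + eta) (xi + eta) + bil (hessian u y) (xi - eta) (xi - eta)
    - 2 * bil (hessian u z) xi xi + P2.
Proof.
move=> uC e0 dP dP1 umin; have [uC1 _] := uC.
have zz a v : a + (0:R) *: v = a :> E by rewrite scale0r addr0.
have d1 a v t := @line_derive R n u a v t uC1.
have d2 a v := @line_derive2 R n u a v v 0 uC.
have := @combined_second_derivative_test _ _ _ P _ _ _ P1 _ _ _ P2 e e0
  (d1 x (xi + eta)) (d2 x (xi + eta)) (d1 y (xi - eta)) (d2 y (xi - eta))
  (d1 z xi) (d2 z xi) dP dP1.
rewrite !(zz x) !(zz y) !(zz z); exact.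
Qed.

(** The barrier and the penalty of k are polynomials along lines: a0 is the
value of psi, m, q, r and l are scalar products of positions and velocities, and
s is |k|^2 - 1, and powers of h enter c, r and l. *)
Lemma is_derive_perturbation (X K c a0 m q s r l t : R) :
  is_derive t (1:R) (fun t => - X * ((a0 - 2 * t * m - t ^+ 2 * q)
     + K * (a0 - 2 * t * m - t ^+ 2 * q) ^+ 2) + c * (s + 2 * t * r + t ^+ 2 * l) ^+ 2)
   (- X * ((- 2 * m - 2 * t * q) * (1 + 2 * K * (a0 - 2 * t * m - t ^+ 2 * q)))
    + c * (2 * (s + 2 * t * r + t ^+ 2 * l) * (2 * r + 2 * t * l))).
Proof. apply: is_derive_eq; rewrite /GRing.scale/=; ring. Qed.

Lemma is_derive_perturbation2 (X K c a0 m q s r l : R) :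
  is_derive (0:R) (1:R) (fun t =>
   (- X * ((- 2 * m - 2 * t * q) * (1 + 2 * K * (a0 - 2 * t * m - t ^+ 2 * q)))
    + c * (2 * (s + 2 * t * r + t ^+ 2 * l) * (2 * r + 2 * t * l))))
   (- X * (- 2 * q * (1 + 2 * K * a0) + 8 * K * m ^+ 2) + c * (8 * r ^+ 2 + 4 * s * l)).
Proof. apply: is_derive_eq; rewrite /GRing.scale/=; ring. Qed.

End SecondVariation.

(** * The second variation traced against the coefficients *)

Section Trace.
Context {R : realType} {n : nat}.
Local Notation E := 'rV[R]_n.
Implicit Types (A : 'M[R]_n) (p d dl : E).

(** Up to terms of second order in dl, the left-hand side is the operator with
coefficients given by p + dl, applied to A. Up to an error linear in X, it has
the value that the equation prescribes at the gradient p + dl + d. The first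
order term in dl is kept, because it cancels against the one for - dl. *)
Lemma trace_expansion_bound A (p dl d : E) (Q c c1 c2 c3 X : R) :
  (1 - dot (p + dl + d) (p + dl + d)) * \tr A + bil A (p + dl + d) (p + dl + d)
    = 1 - dot (p + dl + d) (p + dl + d) ->
  (forall i j, `|A i j| <= c) -> 0 <= c -> 0 <= X -> 0 <= c2 ->
  `|p| <= 1 -> `|dl| <= 1 -> `|d| <= 1 ->
  `|dl| ^+ 2 <= c1 * X -> `|d| <= c2 * X -> 0 <= Q <= c3 * X ->
  (1 - dot p p - 2 * dot p dl + Q) * \tr A + bil A (p + dl) (p + dl) <=
  1 - dot p p - 2 * dot p dl
   + (n%:R * c * (c3 + n%:R * c1 + 5 * n%:R * c2) + 5 * n%:R ^+ 2 * c * c2 + 4 * n%:R * c2) * X.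
Proof.
move=> pde Ac c0 X0 c20 p1 dl1 d1 dl2 dX /andP[Q0 QX].
have N0 : 0 <= n%:R :> R by [].
have dpd : `|dot p d| <= n%:R * (c2 * X).
  apply: (le_trans (dot_le_norm _ _)); rewrite ler_wpM2l//.
  by rewrite -[c2 * X]mul1r ler_pM.
have ddd : `|dot dl d| <= n%:R * (c2 * X).
  apply: (le_trans (dot_le_norm _ _)); rewrite ler_wpM2l//.
  by rewrite -[c2 * X]mul1r ler_pM.
have dd : dot d d <= n%:R * (c2 * X).
  apply: (le_trans (ler_norm _)); apply: (le_trans (dot_le_norm _ _)); rewrite ler_wpM2l//.
  by rewrite -[c2 * X]mul1r ler_pM.
have dldl : dot dl dl <= n%:R * (c1 * X).
  apply: (le_trans (ler_norm _)); apply: (le_trans (dot_le_norm _ _)); rewrite ler_wpM2l//.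
have T := trace_le Ac.
have bl v w a b : `|v| <= a -> `|w| <= b -> `|bil A v w| <= n%:R ^+ 2 * c * (a * b).
  move=> va wb; apply: (le_trans (bil_le_norm _ _ c0 Ac)).
  by rewrite ler_wpM2l ?mulr_ge0 ?exprn_ge0// ler_pM.
have b1 := bl _ _ _ _ p1 dX; have b2 := bl _ _ _ _ dX p1.
have b3 := bl _ _ _ _ dl1 dX; have b4 := bl _ _ _ _ dX dl1.
have b5 := bl _ _ _ _ d1 dX.
have dd0 := dot_ge0 d; have dldl0 := dot_ge0 dl.
have rT : (Q + dot dl dl + dot d d + 2 * dot p d + 2 * dot dl d) * \tr A <=
    (c3 * X + n%:R * (c1 * X) + 5 * (n%:R * (c2 * X))) * (n%:R * c).
  apply: (le_trans (ler_norm _)); rewrite normrM ler_pM//.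
  move: dpd ddd; rewrite !ler_norml => /andP[h1 h2] /andP[h3 h4].
  by apply/andP; split; lra.
move: pde; rewrite !(dotDl, dotDr, bilDl, bilDr) (dotC dl p) (dotC d p) (dotC d dl).
move: (\tr A) T rT b1 b2 b3 b4 b5 dpd ddd => tA T rT.
move: (bil A p p) (bil A p dl) (bil A p d) (bil A dl p) (bil A dl dl) (bil A dl d)
  (bil A d p) (bil A d dl) (bil A d d) => b11 b12 b13 b21 b22 b23 b31 b32 b33.
rewrite !ler_norml !mul1r !mulr1 => /andP[h1 h2] /andP[h3 h4] /andP[h5 h6] /andP[h7 h8]
  /andP[h9 h10] /andP[h11 h12] /andP[h13 h14].
move: dd0 dldl0 dd dldl rT.
move: (dot p p) (dot p dl) (dot p d) (dot dl dl) (dot dl d) (dot d d) h11 h12 h13 h14 => *.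
set B := n%:R ^+ 2 * c * (c2 * X) in h1 h2 h3 h4 h5 h6 h7 h8 h9 h10.
have -> : (n%:R * c * (c3 + n%:R * c1 + 5 * n%:R * c2) + 5 * n%:R ^+ 2 * c * c2 + 4 * n%:R * c2) * X
  = (c3 * X + n%:R * (c1 * X) + 5 * (n%:R * (c2 * X))) * (n%:R * c) + 5 * B + 4 * (n%:R * (c2 * X)).
  by rewrite /B; ring.
lra.
Qed.

(** The constant C of the opening comment: it collects, in this order, the errors
at the two outer points, the isotropic part of the Hessian of the barrier, and the
contributions of the penalty of k. The barrier parameter K does not enter. *)
Definition second_variation_constant (c w0 c1 c2 : R) : R :=
  let N : R := n%:R in
  let c3 := N ^+ 2 * c1 / w0 in
  2 * (N * c * (c3 + N * c1 + 5 * N * c2) + 5 * N ^+ 2 * c * c2 + 4 * N * c2)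
  + 3 * (N + 1) + 8 * (4 * N * c3 + 4 * N ^+ 2 * c1)
  + 4 * (4 * N + 1) * (N * c3 + N * c1).

(** Here X stands for h^2 eps, Z for z - y, B for 1 + 2 K psi(z) and sg for
|k|^2 - 1. *)
Lemma summed_second_variation (Ax Ay Az : 'M[R]_n) (p dl d Z k : E)
  (c w0 c1 c2 X B K sg : R) :
  (1 - dot (p + dl + d) (p + dl + d)) * \tr Ax + bil Ax (p + dl + d) (p + dl + d)
    = 1 - dot (p + dl + d) (p + dl + d) ->
  (1 - dot (p - dl + d) (p - dl + d)) * \tr Ay + bil Ay (p - dl + d) (p - dl + d)
    = 1 - dot (p - dl + d) (p - dl + d) ->
  (1 - dot p p) * \tr Az + bil Az p p = 1 - dot p p ->
  (forall i j, `|Ax i j| <= c) -> (forall i j, `|Ay i j| <= c) ->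
  0 <= c -> 0 < w0 -> 0 <= X -> 0 <= c2 -> 0 <= K ->
  w0 <= 1 - dot p p -> `|dl| <= 1 -> `|d| <= 1 ->
  `|dl| ^+ 2 <= c1 * X -> `|d| <= c2 * X -> B <= 3 / 2 -> `|k| <= 2 ->
  sg = dot k k - 1 ->
  (forall xi eta, 0 <= bil Ax (xi + eta) (xi + eta) + bil Ay (xi - eta) (xi - eta)
     - 2 * bil Az xi xi
     + (- X * (- 2 * dot xi xi * B + 8 * K * dot Z xi ^+ 2)
        + (8 * dot k eta ^+ 2 + 4 * sg * dot eta eta))) ->
  8 * K * X * w0 * dot Z Z <= second_variation_constant c w0 c1 c2 * X.
Proof.
move=> pdex pdey pdez Axc Ayc c0 w00 X0 c20 K0 w0p dl1 d1 dl2 dX B32 k2 sgE SV.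
set N : R := n%:R; have N0 : 0 <= N by [].
set W := 1 - dot p p in w0p.
have W0 : 0 < W by exact: lt_le_trans w0p.
pose w := Num.sqrt W; have w2 : w ^+ 2 = W by rewrite sqr_sqrtr// ltW.
have wpos : 0 < w by rewrite sqrtr_gt0.
have wn0 : w != 0 by rewrite gt_eqF.
have pp0 := dot_ge0 p.
have p1 : `|p| <= 1 by apply: norm_le_dot => //; rewrite expr1n; rewrite /W in W0; lra.
set be := dot p dl.
pose Q := be ^+ 2 / W.
have Q0 : 0 <= Q by rewrite divr_ge0 ?sqr_ge0 ?(ltW W0).
have c1X : 0 <= c1 * X by apply: le_trans dl2; rewrite sqr_ge0.
have beN : `|be| <= N * `|dl|.
  by apply: (le_trans (dot_le_norm _ _)); rewrite ler_wpM2l// ler_piMl.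
have be2 : be ^+ 2 <= N ^+ 2 * (c1 * X).
  have -> : be ^+ 2 = `|be| ^+ 2 by rewrite real_normK ?num_real.
  apply: (@le_trans _ _ ((N * `|dl|) ^+ 2)).
    by rewrite ler_pXn2r ?nnegrE// mulr_ge0.
  by rewrite exprMn ler_wpM2l ?sqr_ge0.
set c3 := N ^+ 2 * c1 / w0.
have QX : Q <= c3 * X.
  rewrite /Q ler_pdivrMr//.
  have -> : c3 * X * W = N ^+ 2 * (c1 * X) * (W / w0) by rewrite /c3; field; rewrite gt_eqF.
  apply: (le_trans be2); apply: ler_peMr; last by rewrite ler_pdivlMr// mul1r.
  by apply: mulr_ge0; first exact: sqr_ge0.
(* The squares of these variations add up to the coefficients of the equation
   at z, and after adding or subtracting eta to those at the two outer points
   up to second order in dl. *)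
have s0 := SV p dl.
have si i := SV (w *: delta_mx 0 i) ((- (be / w)) *: delta_mx 0 i).
have de (i : 'I_n) : dot (delta_mx 0 i : E) (delta_mx 0 i) = 1.
  by rewrite dot_delta mxE !eqxx.
have bd A (a : R) i : bil A (a *: delta_mx 0 i) (a *: delta_mx 0 i) = a ^+ 2 * A i i.
  by rewrite bilZl bilZr bil_delta mulrA expr2.
have ssum : 0 <= \sum_i ((w - be / w) ^+ 2 * Ax i i + (w + be / w) ^+ 2 * Ay i i - 2 * (W * Az i i)
   + (- X * (- 2 * W * B + 8 * K * (W * Z 0 i ^+ 2)) + (8 * (Q * k 0 i ^+ 2) + 4 * sg * Q))).
  apply: sumr_ge0 => i _; have := si i.
  rewrite -scalerDl -scalerBl opprK !bd !dotZl !dotZr !dot_delta !mxE !eqxx !mulr1 -expr2 w2.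
  have -> : - (be / w) * (- (be / w)) = Q by rewrite /Q -w2; field.
  have -> : (w * Z 0 i) ^+ 2 = W * Z 0 i ^+ 2 by rewrite exprMn w2.
  have -> : (- (be / w) * k 0 i) ^+ 2 = Q * k 0 i ^+ 2 by rewrite /Q -w2; field.
  done.
have sumsq (v : E) : \sum_i v 0 i ^+ 2 = dot v v.
  by rewrite dotE; apply: eq_bigr => i _; rewrite expr2.
have trE A : \sum_i A i i = \tr A by [].
have cstE (a : R) : \sum_(i < n) a = N * a by rewrite sumr_const card_ord mulr_natl.
move: ssum; rewrite !(big_split, sumrN) /= -!mulr_sumr !(big_split, sumrN) /= -!mulr_sumr !trE !sumsq !cstE.
have -> : be ^+ 2 * (N / W) = N * Q by rewrite /Q; ring.
move=> ssum.
have x1 := @trace_expansion_bound Ax p dl d Q c c1 c2 c3 X pdex Axc c0 X0 c20 p1 dl1 d1 dl2 dX.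
have {}x1 := x1 (introT andP (conj Q0 QX)).
have y1 := @trace_expansion_bound Ay p (- dl) d Q c c1 c2 c3 X pdey Ayc c0 X0 c20 p1.
rewrite normrN in y1.
have {}y1 := y1 dl1 d1 dl2 dX (introT andP (conj Q0 QX)).
have e1 : (w - be / w) ^+ 2 = 1 - dot p p - 2 * be + Q by rewrite -/W /Q -w2; field.
have e2 : (w + be / w) ^+ 2 = 1 - dot p p - 2 * dot p (- dl) + Q.
  by rewrite -/W /Q dotNr -/be -w2; field.
rewrite -e1 -/N -/be in x1; rewrite -e2 dotNr -/be -/N in y1.
have kk : dot k k <= N * 4.
  apply: (le_trans (ler_norm _)); apply: (le_trans (dot_le_norm _ _)); rewrite ler_wpM2l//.
  rewrite (_ : 4 = 2 * 2); first exact: ler_pM.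
  by rewrite -natrM.
have kk0 := dot_ge0 k.
have dldl : dot dl dl <= N * (c1 * X).
  by apply: (le_trans (ler_norm _)); apply: (le_trans (dot_le_norm _ _)); rewrite ler_wpM2l.
have dldl0 := dot_ge0 dl.
have kdl : dot k dl ^+ 2 <= 4 * N ^+ 2 * (c1 * X).
  have -> : dot k dl ^+ 2 = `|dot k dl| ^+ 2 by rewrite real_normK ?num_real.
  apply: (@le_trans _ _ ((N * (2 * `|dl|)) ^+ 2)).
    rewrite ler_pXn2r ?nnegrE ?mulr_ge0//; apply: (le_trans (dot_le_norm _ _)).
    by rewrite ler_wpM2l// ler_wpM2r.
  have -> : (N * (2 * `|dl|)) ^+ 2 = 4 * N ^+ 2 * `|dl| ^+ 2 by ring.
  by rewrite ler_wpM2l// mulr_ge0 ?sqr_ge0.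
have Zp : 0 <= dot Z p ^+ 2 by rewrite sqr_ge0.
have ZZ := dot_ge0 Z.
have t1 : Q * dot k k <= 4 * N * (c3 * X).
  have -> : 4 * N * (c3 * X) = (c3 * X) * (N * 4) by ring.
  exact: ler_pM.
have sgN : sg <= 4 * N + 1 by rewrite sgE (mulrC 4) lerD// (@le_trans _ _ 0).
have t2 : sg * (N * Q + dot dl dl) <= (4 * N + 1) * (N * (c3 * X) + N * (c1 * X)).
  apply: (@le_trans _ _ ((4 * N + 1) * (N * Q + dot dl dl))).
    by rewrite ler_wpM2r// addr_ge0// mulr_ge0.
  rewrite ler_wpM2l//; first by rewrite addr_ge0// mulr_ge0.
  by rewrite lerD// ler_wpM2l.
have t3 : X * ((N * W + dot p p) * B) <= X * ((N + 1) * (3 / 2)).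
  rewrite ler_wpM2l//.
  have q0 : 0 <= N * W + dot p p by rewrite addr_ge0// mulr_ge0// ltW.
  apply: (@le_trans _ _ ((N * W + dot p p) * (3 / 2))); first by rewrite ler_wpM2l.
  rewrite ler_wpM2r// lerD//; last by rewrite -subr_ge0 -/W ltW.
  by rewrite ler_piMr// /W gerBl.
have t4 : 8 * K * X * w0 * dot Z Z <= 8 * K * X * W * dot Z Z + 8 * K * X * dot Z p ^+ 2.
  have q : 0 <= 8 * K * X by rewrite !mulr_ge0.
  apply: ler_wpDr; first exact: mulr_ge0.
  by apply: ler_wpM2r => //; apply: ler_wpM2l.
rewrite /second_variation_constant -/N -/c3.
move: pdez; rewrite -/W => pdez.
move: s0 ssum x1 y1 pdez t1 t2 t3 t4 kdl.
rewrite /=.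
move: ((w - be / w) ^+ 2) ((w + be / w) ^+ 2) => v1 v2.
move: (\tr Ax) (\tr Ay) (\tr Az) (bil Ax _ _) (bil Ay _ _) (bil Az _ _) => tx ty tz bx by_ bz.
move: (dot k dl) (dot k k) (dot dl dl) (dot Z p) (dot Z Z) => kdl' kk' dl' Zp' ZZ'.
have -> : dot p p = 1 - W by rewrite /W; ring.
clearbody W Q c3 N => s0 ssum x1 y1 pdez t1 t2 t3 t4 kdl.
clear - s0 ssum x1 y1 pdez t1 t2 t3 t4 kdl.
lra.
Qed.
End Trace.

(** * The minimum of the second difference functional *)

Section Assembly.
Context {R : realType} {n : nat}.
Local Notation E := 'rV[R]_n.
Implicit Types (u : E -> R).

Lemma convex_second_difference u :
  @convex_function R 'rV[R]_n [set: 'rV[R]_n] u ->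
  forall z k, 0 <= u (z + k) + u (z - k) - 2 * u z.
Proof.
move=> uconv z k.
have h01 : 0 <= (2^-1 : R) <= 1 by apply/andP; split; lra.
have := uconv (Itv01 (andP h01).1 (andP h01).2) (z + k) (z - k) (in_setT _) (in_setT _).
rewrite convRE /conv /= /unstable.onem.
have -> : (1 - 2^-1 : R) = 2^-1 by lra.
have -> : 2^-1 *: (z + k) + 2^-1 *: (z - k) = z by apply/rowP => i; rewrite !mxE; field.
lra.
Qed.

Lemma convex_hessian_ge0 u : C2 u ->
  @convex_function R 'rV[R]_n [set: 'rV[R]_n] u ->
  forall z v, 0 <= bil (hessian u z) v v.
Proof.
move=> uC uconv z v.
have H0 t : is_derive (t:R) (1:R) (cst (0:R)) (cst 0 t) by exact: is_derive_cst.
have [|_] := @second_variation R n u z z z 0 v (cst 0) (cst 0) 0 1 uC ltr01 H0 (H0 0).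
  move=> t _; rewrite add0r sub0r scaler0 addr0 scalerN !addr0.
  have := convex_second_difference uconv z (t *: v).
  by move: (u _) (u _) (u _) => ? ? ?; lra.
rewrite add0r sub0r bilNl bilNr opprK /bil mul0mx {3}/dot mul0mx mxE.
by move: (dot _ _) => ?; lra.
Qed.

Lemma second_difference_approx u z k (h r e : R) : C2 u -> 0 < h ->
  (forall y, `|y| < r -> `|bil (hessian u (z + y)) k k - bil (hessian u z) k k| < e) ->
  h * `|k| < r ->
  `|(h ^+ 2)^-1 * (u (z + h *: k) + u (z - h *: k) - 2 * u z) - bil (hessian u z) k k| <= e.
Proof.
move=> uC h0 Hr hk; have [uC1 _] := uC.
have [s /andP[s0 s1]] := second_difference_mean
  (fun t => line_derive z (h *: k) t uC1) (fun t => line_derive2 z (h *: k) (h *: k) t uC).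
rewrite !scaleNr !scale1r scale0r addr0 => ->.
move: (hessian u) Hr => H Hr.
rewrite !bilZl !bilZr.
have near (t : R) : `|t| < 1 -> `|t *: (h *: k)| < r.
  move=> t1; rewrite !normrZ (gtr0_norm h0); apply: le_lt_trans hk.
  by rewrite -[leRHS]mul1r ler_wpM2r ?mulr_ge0// ltW.
have h1 := Hr _ (near s (_ : `|s| < 1)).
have h2 := Hr _ (near (- s) (_ : `|- s| < 1)).
rewrite normrN (gtr0_norm s0) s1 scaleNr in h1 h2.
move: (h1 isT) (h2 isT).
move: (bil (H (z + s *: _)) k k) => a; move: (bil (H (z - s *: _)) k k) => b.
move: (bil (H z) k k) => c.
rewrite !ltr_norml ler_norml => /andP[a1 a2] /andP[b1 b2].
have -> : (h ^+ 2)^-1 * ((h * (h * a) + h * (h * b)) / 2) = (a + b) / 2.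
  by field; rewrite gt_eqF.
by apply/andP; split; lra.
Qed.

Definition paraboloid (y : E) (d0 : R) (z : E) : R := d0 - dot (z - y) (z - y).
(** The quadratic term makes the second derivative along the gradient as large as
wanted, while the values and the gradient near the zero set of the paraboloid
stay comparable to those of the paraboloid. *)
Definition barrier (y : E) (d0 K : R) (z : E) : R :=
  paraboloid y d0 z + K * paraboloid y d0 z ^+ 2.

Lemma paraboloid_line y d0 z xi (t : R) : paraboloid y d0 (z + t *: xi) =
  paraboloid y d0 z - 2 * t * dot (z - y) xi - t ^+ 2 * dot xi xi.
Proof.
rewrite /paraboloid addrAC.
rewrite !(dotDl (z - y)) !(dotDr (z - y)) !dotZl !dotZr (dotC xi); ring.
Qed.

(** The functional is multiplied by h^2, so that X is h^2 eps, and the variation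
of h k is called eta, so that k itself moves with velocity eta / h. *)
Lemma interior_minimum_conditions u y z k (d0 K X h rho : R) : C2 u ->
  0 < h -> 0 < rho ->
  let Phi z k := u (z + h *: k) + u (z - h *: k) - 2 * u z - X * barrier y d0 K z
     + h ^+ 2 * (dot k k - 1) ^+ 2 in
  (forall z' k', `|z' - z| < rho -> `|k' - k| < rho -> Phi z k <= Phi z' k') ->
  let sg := dot k k - 1 in
  let B := 1 + 2 * K * paraboloid y d0 z in
  let p := gradient u z in
  let dl := (- 2 * sg * h) *: k in let d := (- X * B) *: (z - y) in
  [/\ gradient u (z + h *: k) = p + dl + d,
      gradient u (z - h *: k) = p - dl + d &
  forall xi eta, 0 <= bil (hessian u (z + h *: k)) (xi + eta) (xi + eta)
     + bil (hessian u (z - h *: k)) (xi - eta) (xi - eta)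
     - 2 * bil (hessian u z) xi xi
     + (- X * (- 2 * dot xi xi * B + 8 * K * dot (z - y) xi ^+ 2)
        + (8 * dot k eta ^+ 2 + 4 * sg * dot eta eta))].
Proof.
move=> uC h0 rho0 Phi Pmin sg B p dl d.
have hn0 : h != 0 by rewrite gt_eqF.
have main xi eta :
  dot (xi + eta) (gradient u (z + h *: k)) + dot (xi - eta) (gradient u (z - h *: k))
    - 2 * dot xi p + (2 * X * B * dot (z - y) xi + 4 * h * sg * dot k eta) = 0 /\
  0 <= bil (hessian u (z + h *: k)) (xi + eta) (xi + eta)
     + bil (hessian u (z - h *: k)) (xi - eta) (xi - eta)
     - 2 * bil (hessian u z) xi xi
     + (- X * (- 2 * dot xi xi * B + 8 * K * dot (z - y) xi ^+ 2)
        + (8 * dot k eta ^+ 2 + 4 * sg * dot eta eta)).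
  pose a0 := paraboloid y d0 z; pose m := dot (z - y) xi; pose q := dot xi xi.
  pose r := h^-1 * dot k eta; pose l := h^-1 * (h^-1 * dot eta eta).
  have D1 t := is_derive_perturbation X K (h ^+ 2) a0 m q sg r l t.
  have D2 := is_derive_perturbation2 X K (h ^+ 2) a0 m q sg r l.
  pose N := `|xi| + `|h^-1 *: eta| + 1.
  have N0 : 0 < N by rewrite ltr_wpDl// addr_ge0.
  have e0 : 0 < rho / N by rewrite divr_gt0.
  have small (t : R) v : `|t| < rho / N -> `|v| <= N -> `|t *: v| < rho.
    move=> tN vN; rewrite normrZ; apply: (@le_lt_trans _ _ (`|t| * N)).
      by rewrite ler_wpM2l.
    by rewrite -ltr_pdivlMr.
  have [|f1 f2] := @second_variation R n u (z + h *: k) (z - h *: k) z xi eta _ _ _ _ uC e0 D1 D2.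
    move=> t te; pose z' := z + t *: xi; pose k' := k + t *: (h^-1 *: eta).
    have zz' : `|z' - z| < rho.
      by rewrite /z' (addrC z) addrK; apply: small => //; rewrite /N -addrA lerDl addr_ge0.
    have kk' : `|k' - k| < rho.
      rewrite /k' (addrC k) addrK; apply: small => //.
      by rewrite /N -addrA addrCA lerDl addr_ge0.
    have := Pmin z' k' zz' kk'; rewrite /Phi /barrier.
    have -> : dot k' k' - 1 = sg + 2 * t * r + t ^+ 2 * l.
      by rewrite /sg /r /l /k' !(dotDl, dotDr, dotZl, dotZr) (dotC eta k); ring.
    have -> : z' + h *: k' = z + h *: k + t *: (xi + eta).
      by apply/rowP => i; rewrite !mxE; field.
    have -> : z' - h *: k' = z - h *: k + t *: (xi - eta).
      by apply/rowP => i; rewrite !mxE; field.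
    rewrite paraboloid_line -/a0 -/m -/q /z'.
    move: (u _) (u _) (u _) (u _) (u _) (u _) => u1 u2 u3 u4 u5 u6.
    rewrite -/sg => P0.
    rewrite !mulr0 !mul0r expr0n/= !mul0r !subr0 !addr0; lra.
  have e1 : - X * ((- 2 * m - 2 * 0 * q) * (1 + 2 * K * (a0 - 2 * 0 * m - 0 ^+ 2 * q)))
    + h ^+ 2 * (2 * (sg + 2 * 0 * r + 0 ^+ 2 * l) * (2 * r + 2 * 0 * l))
    = 2 * X * B * dot (z - y) xi + 4 * h * sg * dot k eta.
    by rewrite /B -/a0 /r -/m; move: (dot k eta) => *; field.
  have e2 : - X * (- 2 * q * (1 + 2 * K * a0) + 8 * K * m ^+ 2)
    + h ^+ 2 * (8 * r ^+ 2 + 4 * sg * l)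
    = - X * (- 2 * q * B + 8 * K * m ^+ 2) + (8 * dot k eta ^+ 2 + 4 * sg * dot eta eta).
    by rewrite /B -/a0 /r /l; move: (dot k eta) (dot eta eta) => *; field.
  by rewrite e1 in f1; rewrite e2 in f2.
have gsum i : gradient u (z + h *: k) 0 i + gradient u (z - h *: k) 0 i
    - 2 * p 0 i + 2 * X * B * (z - y) 0 i = 0.
  have [e1 _] := main (delta_mx 0 i) 0.
  move: e1; rewrite addr0 subr0 !(dotC (delta_mx 0 i)) !dot_delta [dot k 0]dotC.
  by rewrite {1}/dot mul0mx [_ 0 0]mxE mulr0 addr0.
have gdiff i : gradient u (z + h *: k) 0 i - gradient u (z - h *: k) 0 i
    + 4 * h * sg * k 0 i = 0.
  have [e1 _] := main 0 (delta_mx 0 i).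
  move: e1; rewrite add0r sub0r dotNl !(dotC (delta_mx 0 i)) !dot_delta [dot (z - y) 0]dotC.
  by rewrite /dot !mul0mx [_ 0 0]mxE !mulr0 subr0 add0r.
split; last by move=> xi eta; have [] := main xi eta.
- apply/rowP => i; have := gsum i; have := gdiff i; rewrite /dl /d.
  clear main gsum gdiff; clearbody p.
  move: (gradient u (z + h *: k)) => g1; move: (gradient u (z - h *: k)) => g2.
  rewrite !mxE; lra.
- apply/rowP => i; have := gsum i; have := gdiff i; rewrite /dl /d.
  clear main gsum gdiff; clearbody p.
  move: (gradient u (z + h *: k)) => g1; move: (gradient u (z - h *: k)) => g2.
  rewrite !mxE; lra.
Qed.
End Assembly.

(** * The strong minimum principle *)

Section Final.
Context {R : realType} {n : nat}.
Local Notation E := 'rV[R]_n.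
Implicit Types (u : E -> R).

Lemma cont_fst_norm (x0 : E) : continuous (fun q : E * E => `|q.1 - x0|).
Proof.
move=> q; have fc : {for q, continuous (fun q : E * E => q.1 - x0)}.
  by apply: cvgB; [exact: cvg_fst|exact: cvg_cst].
exact: (continuous_comp fc (@norm_continuous _ _ _)).
Qed.

Lemma cont_snd_norm : continuous (fun q : E * E => `|q.2|).
Proof.
move=> q; have fc : {for q, continuous (fun q : E * E => q.2)} by exact: cvg_snd.
exact: (continuous_comp fc (@norm_continuous _ _ _)).
Qed.

Lemma compact_box (x0 : E) (a b : R) : 0 <= a -> 0 <= b ->
  compact [set q : E * E | `|q.1 - x0| <= a /\ `|q.2| <= b].
Proof.
move=> a0 b0; apply: (@compact_closed_bounded _ _ _ (a + b + `|x0|)).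
  have -> : [set q : E * E | `|q.1 - x0| <= a /\ `|q.2| <= b] =
    [set q : E * E | `|q.1 - x0| <= a] `&` [set q : E * E | `|q.2| <= b] by [].
  apply: closedI; apply: closed_sublevel; [exact: cont_fst_norm|exact: cont_snd_norm].
move=> [z v] /= [h1 h2]; have := normr_ge0 x0; split; last by lra.
by rewrite -[z](subrK x0) (le_trans (ler_normD _ _))//; lra.
Qed.

Lemma local_bounds u x0 : C2 u ->
  (forall x, dot (gradient u x) (gradient u x) < 1) ->
  exists c w0, [/\ 0 <= c, 0 < w0,
    forall z i j, `|z - x0| <= 3 -> `|hessian u z i j| <= c &
    forall z, `|z - x0| <= 3 -> w0 <= 1 - dot (gradient u z) (gradient u z)].
Proof.
move=> uC lt1; have bc : compact [set q : E * E | `|q.1 - x0| <= 3 /\ `|q.2| <= 1] by exact: compact_box.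
have Hc i j := @hessian_continuous R n u i j uC.
have gc := gradient_continuous uC.
move: (hessian u) (gradient u) lt1 Hc gc => H g lt1 Hc gc.
have gfc : continuous (fun q : E * E => g q.1).
  move=> q; have fc : {for q, continuous (@fst E E)} by exact: cvg_fst.
  exact: (continuous_comp fc (@gc q.1)).
have sc : continuous (fun q : E * E => \sum_i \sum_j `|H q.1 i j|).
  apply: cont_sum => i; apply: cont_sum => j q.
  exact: (continuous_comp (@cont_entry_fst _ _ H Hc i j q) (@norm_continuous _ _ _)).
have [c c0 cH] := compact_bounded_above bc sc.
have wc : continuous (fun q : E * E => 1 - dot (g q.1) (g q.1)).
  by move=> q; apply: cvgB; [exact: cvg_cst|apply: cont_dot].
have [|w0 w00 wH] := positive_lower_bound bc wc.
  by move=> q _; rewrite subr_gt0.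
exists c, w0; split => //; first exact: ltW.
- move=> z i j zx; have := cH (z, 0); rewrite /= normr0 => /(_ (conj zx ler01)).
  apply: le_trans; rewrite (bigD1 i)//= (bigD1 j)//= -addrA lerDl addr_ge0//.
    by apply: sumr_ge0 => k _.
  by apply: sumr_ge0 => k _; apply: sumr_ge0.
- by move=> z zx; apply: (wH (z, 0)); rewrite /= normr0.
Qed.

Lemma paraboloid_continuous (y : E) d0 : continuous (paraboloid y d0).
Proof.
have sc : continuous (fun z : E => z - y).
  apply: (@cont_subr_cst _ _ _ (fun z : E => z) y) => q; exact: cvg_id.
have dc := cont_dot sc sc.
move=> z; apply: (@cvgB _ _ _ (nbhs z) _ (fun=> d0) (fun z => dot (z - y) (z - y))).
  exact: cvg_cst.
exact: dc.
Qed.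

(** The limit functional bil (H z) k k - eps phi z + (|k|^2 - 1)^2 is positive at
the boundary of the box: where phi is negative because all the other terms are
nonnegative, elsewhere because H z is definite and eps is small. Any
functional e-close to it for small e then has an interior minimum, its value at
(x0, e0) being at most e. *)
Lemma exists_interior_min (H : E -> 'M[R]_n) (phi : E -> R) (x0 e0 : E) (rho M : R) :
  (forall i j, continuous (fun x => H x i j)) -> (forall z v, 0 <= bil (H z) v v) ->
  continuous phi -> 0 < rho -> 0 < M -> phi x0 = 0 ->
  dot e0 e0 = 1 -> bil (H x0) e0 e0 <= 0 ->
  (forall z, `|z - x0| <= rho -> phi z < M) ->
  (forall z, `|z - x0| <= rho -> z != x0 -> 0 <= phi z -> posbil (H z)) ->
  exists eps e r, [/\ 0 < eps <= 1, 0 < e <= eps, 0 < r,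
    forall z k y, `|z - x0| <= rho -> `|k| <= 2 -> `|y| < r ->
      `|bil (H (z + y)) k k - bil (H z) k k| < e &
    forall Theta : E * E -> R, continuous Theta ->
      (forall z k, `|z - x0| <= rho -> `|k| <= 2 -> `|Theta (z, k) - bil (H z) k k| <= e) ->
      let Phi z k := Theta (z, k) - eps * phi z + (dot k k - 1) ^+ 2 in
      exists z k, [/\ `|z - x0| < rho, `|k| < 2, Phi z k <= e &
        forall z' k', `|z' - x0| <= rho -> `|k'| <= 2 -> Phi z k <= Phi z' k'] ].
Proof.
move=> Hc H0 phic rho0 M0 phix0 e01 He0 phiM phi_pos.
pose A : set (E * E) := [set q | `|q.1 - x0| <= rho /\ `|q.2| <= 2].
pose Bd : set (E * E) := A `&`
   ([set q | rho <= `|q.1 - x0|] `|` [set q | 2 <= `|q.2|]).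
have Ac : compact A by apply: compact_box => //; exact: ltW.
have Acl : closed A.
  have -> : A = [set q : E * E | `|q.1 - x0| <= rho] `&` [set q : E * E | `|q.2| <= 2] by [].
  by apply: closedI; apply: closed_sublevel; [exact: cont_fst_norm|exact: cont_snd_norm].
have Bdcl : closed Bd.
  apply: closedI => //.
  by apply: closedU; apply: closed_superlevel; [exact: cont_fst_norm|exact: cont_snd_norm].
pose Pf (q : E * E) := bil (H q.1) q.2 q.2 + (dot q.2 q.2 - 1) ^+ 2.
have pc : continuous (fun q : E * E => (dot q.2 q.2 - 1) ^+ 2).
  have sc : continuous (fun q : E * E => dot q.2 q.2 - 1).
    move=> q; apply: cvgB; last exact: cvg_cst.
    by apply: cont_dot => q'; exact: cvg_snd.
  have -> : (fun q : E * E => (dot q.2 q.2 - 1) ^+ 2) =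
    (fun q : E * E => (dot q.2 q.2 - 1) * (dot q.2 q.2 - 1)).
    by apply/funext => q; rewrite expr2.
  by move=> q; apply: cvgM; exact: sc.
have Pfc : continuous Pf.
  by move=> q; apply: cvgD; [exact: cont_bil_pair|exact: pc].
have phi1c : continuous (fun q : E * E => phi q.1).
  move=> q; have fc : {for q, continuous (@fst E E)} by exact: cvg_fst.
  exact: (continuous_comp fc (@phic q.1)).
have Pf0 q : 0 <= Pf q by rewrite addr_ge0// sqr_ge0.
have B1c : compact (Bd `&` [set q | 0 <= phi q.1]).
  apply: (subclosed_compact _ Ac); last by move=> q [[]].
  by apply: closedI => //; exact: closed_superlevel.
(* If |k| = 1 then k is interior to the cube, so z is on the boundary of the
   box around x0 and in particular z differs from x0. *)
have [|m0 m00 Pm0] := positive_lower_bound B1c Pfc.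
  move=> [z k] [[[/= zr k2] bd] phz]; rewrite /Pf/=.
  have [kk|kk] := eqVneq (dot k k) 1; last first.
    by rewrite ltr_wpDl// lt_neqAle sqr_ge0 andbT eq_sym sqrf_eq0 subr_eq0.
  rewrite kk subrr expr0n addr0.
  have k1 : `|k| <= 1 by apply: norm_le_dot; rewrite ?kk ?expr1n.
  case: bd => /= bd; last by have := le_trans bd k1; lra.
  apply: (phi_pos z) => //.
    by apply/eqP => zx0; move: bd; rewrite zx0 subrr normr0 leNgt rho0.
  by apply/eqP => k0; move: kk; rewrite k0 /dot mul0mx mxE => /eqP; rewrite eq_sym oner_eq0.
pose eps := Num.min 1 (m0 / M).
have eps0 : 0 < eps by rewrite lt_min ltr01 divr_gt0.
have eps1 : eps <= 1 by rewrite ge_min lexx.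
have epsM : eps * M <= m0 by rewrite -ler_pdivlMr// ge_min lexx orbT.
pose L (q : E * E) := Pf q - eps * phi q.1.
have Lc : continuous L.
  move=> q; apply: cvgB; first exact: Pfc.
  by apply: cvgM; [exact: cvg_cst|exact: phi1c].
have Bdc : compact Bd by apply: (subclosed_compact Bdcl Ac) => q [].
have [|cL cL0 LcL] := positive_lower_bound Bdc Lc.
  move=> q bdq; rewrite /L; have [ph|ph] := ltP (phi q.1) 0.
    have : eps * phi q.1 < 0 by rewrite pmulr_rlt0.
    have := Pf0 q; lra.
  rewrite subr_gt0; apply: (@lt_le_trans _ _ (eps * M)).
    by rewrite ltr_pM2l// phiM//; case: bdq => -[].
  by apply: (le_trans epsM); exact: Pm0.
pose e := Num.min eps (cL / 4).
have e0' : 0 < e by rewrite lt_min eps0 divr_gt0.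
have e_eps : e <= eps by rewrite ge_min lexx.
have e_cL : e <= cL / 4 by rewrite ge_min lexx orbT.
pose G (p : E * (E * E)) := bil (H (p.2.1 + p.1)) p.2.2 p.2.2 - bil (H p.2.1) p.2.2 p.2.2.
have Gc : continuous G.
  have c1 : continuous (fun p : E * (E * E) => p.2.1).
    by move=> p; apply: (cvg_comp _ _ cvg_snd); exact: cvg_fst.
  have c2 : continuous (fun p : E * (E * E) => p.2.2).
    by move=> p; apply: (cvg_comp _ _ cvg_snd); exact: cvg_snd.
  have c3 : continuous (fun p : E * (E * E) => p.2.1 + p.1).
    by move=> p; apply: cvgD; [exact: c1|exact: cvg_fst].
  have g1 : continuous (fun p : E * (E * E) => bil (H (p.2.1 + p.1)) p.2.2 p.2.2).
    apply: cont_bil => // i j p; exact: (continuous_comp (c3 p) (@Hc i j _)).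
  have g2 : continuous (fun p : E * (E * E) => bil (H p.2.1) p.2.2 p.2.2).
    apply: cont_bil => // i j p; exact: (continuous_comp (c1 p) (@Hc i j _)).
  by move=> p; apply: cvgB; [exact: g1|exact: g2].
have [|r r0 Hr] := uniform_small e0' Ac Gc.
  by move=> q _; rewrite /G/= addr0 subrr.
exists eps, e, r; split => //; try by apply/andP.
  by move=> z k y zr k2 yr; apply: (Hr y (z, k)).
move=> Theta Tc TH Phi.
have Phic : continuous (fun q : E * E => Phi q.1 q.2).
  move=> q; rewrite /Phi; apply: cvgD; last exact: pc.
  apply: cvgB; last by apply: cvgM; [exact: cvg_cst|exact: phi1c].
  have -> : (fun q : E * E => Theta (q.1, q.2)) = Theta by apply/funext => -[].
  exact: Tc.
have e02 : `|e0| <= 2.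
  by apply: (@le_trans _ _ 1); [apply: norm_le_dot; rewrite ?e01 ?expr1n|lra].
have Ax0 : A (x0, e0) by split; rewrite /= ?subrr ?normr0// ltW.
have [[z k] [/= zr k2] qmin] := exists_min Ac (ex_intro _ _ Ax0) Phic.
have Phix0 : Phi x0 e0 <= e.
  have := TH x0 e0; rewrite subrr normr0 => /(_ (ltW rho0) e02).
  by rewrite /Phi phix0 e01 subrr expr0n mulr0 /= ler_norml => /andP[]; lra.
have Pe : Phi z k <= e by apply: (le_trans (qmin _ Ax0)).
have notBd : ~ Bd (z, k).
  move=> bd; have := LcL _ bd; have := TH z k zr k2; move: Pe.
  by rewrite /L /Pf /Phi /= ler_norml => + /andP[]; lra.
exists z, k; split => //.
- by rewrite ltNge; apply/negP => h; apply: notBd; split => //; left.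
- by rewrite ltNge; apply/negP => h; apply: notBd; split => //; right.
- by move=> z' k' zr' k2'; apply: (qmin (z', k')).
Qed.

(** The parameters are fixed in the order K, rho, eps, h. The bounds c, w0, c1
and c2, hence the constant C, have to be available before K is chosen, which is
why phi is bounded through |K psi| <= 1/4 on the box of size rho. *)
Lemma no_degenerate_touching u (x0 e0 y : E) :
  C2 u -> @convex_function R 'rV[R]_n [set: 'rV[R]_n] u ->
  (forall x, dot (gradient u x) (gradient u x) < 1) ->
  (forall x, (1 - dot (gradient u x) (gradient u x)) * \tr (hessian u x)
     + bil (hessian u x) (gradient u x) (gradient u x)
     = 1 - dot (gradient u x) (gradient u x)) ->
  0 < dot (x0 - y) (x0 - y) -> dot e0 e0 = 1 -> bil (hessian u x0) e0 e0 <= 0 ->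
  (forall z, dot (z - y) (z - y) <= dot (x0 - y) (x0 - y) -> z != x0 ->
     posbil (hessian u z)) -> False.
Proof.
move=> uC uconv lt1 pde d00 e01 He0 ball_pos.
have [c [w0 [c0 w00 cH w0H]]] := local_bounds x0 uC lt1.
set d0 := dot (x0 - y) (x0 - y) in d00 ball_pos.
(* M bounds phi + 1 and |z - y| on the box, c1 X bounds |dl|^2 and c2 X bounds
   |d|, with X = h^2 eps. *)
pose M := 2 * d0 + 1; pose c1 := 16 * M; pose c2 := 2 * M.
have M0 : 0 < M by rewrite /M; lra.
pose C := @second_variation_constant R n c w0 c1 c2.
pose K := (`|C| + 1) / (4 * w0 * d0).
have K0 : 0 < K by rewrite divr_gt0 ?mulr_gt0// ltr_wpDl.
pose psi := paraboloid y d0; pose phi := barrier y d0 K.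
have psix0 : psi x0 = 0 by rewrite /psi /paraboloid subrr.
have psic : continuous psi by exact: paraboloid_continuous.
have [rho0 rho00 psi_small] : exists2 r, 0 < r & forall z, `|z - x0| < r ->
    `|psi z| < Num.min (1 / (4 * K)) (d0 / 2).
  have m0 : 0 < Num.min (1 / (4 * K)) (d0 / 2) by rewrite lt_min !divr_gt0// mulr_gt0.
  have /cvgrPdist_lt/(_ _ m0)/nbhs_ballP[r /= r0 Hr] := psic x0.
  exists r => // z zr; have := Hr z; rewrite -ball_normE /= distrC => /(_ zr).
  by rewrite psix0 sub0r normrN.
pose rho := Num.min 1 (rho0 / 2).
have rhopos : 0 < rho by rewrite lt_min ltr01 divr_gt0.
have rho1 : rho <= 1 by rewrite ge_min lexx.
have psiK z : `|z - x0| <= rho -> `|K * psi z| <= 1 / 4 /\ `|psi z| <= d0 / 2.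
  move=> zr; have : `|psi z| < Num.min (1 / (4 * K)) (d0 / 2).
    apply: psi_small; apply: (le_lt_trans zr).
    apply: (@le_lt_trans _ _ (rho0 / 2)); first by rewrite ge_min lexx orbT.
    by lra.
  rewrite lt_min => /andP[h1 h2]; split; last exact: ltW.
  rewrite normrM (gtr0_norm K0); apply: (@le_trans _ _ (K * (1 / (4 * K)))).
    by rewrite ler_pM2l// ltW.
  by rewrite le_eqVlt; apply/orP; left; apply/eqP; field; rewrite gt_eqF.
have phiE z : phi z = psi z * (1 + K * psi z) by rewrite /phi /barrier -/(psi z); ring.
have phi_neg z : `|z - x0| <= rho -> psi z < 0 -> phi z < 0.
  move=> /psiK[]; rewrite ler_norml => /andP[h1 h2] _ h3.
  by rewrite phiE nmulr_rlt0//; lra.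
have phi_le z : `|z - x0| <= rho -> phi z <= 2 * d0.
  move=> zr; have [h|h] := ltP (psi z) 0.
    by apply: (le_trans (ltW (phi_neg z zr h))); lra.
  move: (psiK z zr); rewrite !ler_norml => -[/andP[h1 h2] /andP[h3 h4]].
  rewrite phiE (le_trans (_ : _ <= psi z * 2))//; last by lra.
  by rewrite ler_wpM2l//; lra.
have phic : continuous phi.
  have -> : phi = (fun z => psi z + K * (psi z * psi z)).
    by apply/funext => z; rewrite /phi /barrier expr2.
  move=> z; exact: (cvgD (psic z) (cvgM (cvg_cst K) (cvgM (psic z) (psic z)))).
have [|||eps [e [r [/andP[eps0 eps1] /andP[e0' e_eps] r0 Hr minE]]]] :=
  @exists_interior_min (hessian u) phi x0 e0 rho M
    (fun i j => @hessian_continuous R n u i j uC) (convex_hessian_ge0 uC uconv)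
    phic rhopos M0 _ e01 He0.
- by rewrite phiE psix0 mul0r.
- by move=> z zr; apply: (le_lt_trans (phi_le z zr)); rewrite /M; lra.
- move=> z zr zx0 ph; apply: ball_pos => //.
  have : 0 <= psi z by rewrite leNgt; apply/negP => /(phi_neg z zr); rewrite ltNge ph.
  by rewrite /psi /paraboloid subr_ge0.
have N1 : 0 < 1 + c1 + c2 by rewrite /c1 /c2; lra.
pose h := Num.min 1 (Num.min (r / 4) (1 / (1 + c1 + c2))).
have h0 : 0 < h by rewrite !lt_min ltr01 !divr_gt0.
have h1 : h <= 1 by rewrite !ge_min lexx.
have hr : h <= r / 4 by rewrite !ge_min lexx !orbT.
have hc : h * (1 + c1 + c2) <= 1 by rewrite -ler_pdivlMr// !ge_min lexx !orbT.
have h2 : 0 < h ^+ 2 by rewrite exprn_gt0.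
have h2h : h ^+ 2 <= h by rewrite expr2 ler_piMl// ltW.
pose X := h ^+ 2 * eps.
have X0 : 0 < X by rewrite mulr_gt0.
have Xh : X <= h by apply: (le_trans _ h2h); rewrite ler_piMr// ltW.
pose Theta (q : E * E) := (h ^+ 2)^-1 * (u (q.1 + h *: q.2) + u (q.1 - h *: q.2) - 2 * u q.1).
have uc : continuous u.
  by move=> x; apply: differentiable_continuous; case: uC => -[].
have Thetac : continuous Theta.
  have c1' : continuous (fun q : E * E => q.1) by move=> q; exact: cvg_fst.
  have c2' : continuous (fun q : E * E => h *: q.2).
    move=> q; have sc : {for q, continuous (@snd E E)} by exact: cvg_snd.
    exact: (continuous_comp sc (@scaler_continuous _ _ h _)).
  have c3' : continuous (fun q : E * E => q.1 + h *: q.2).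
    by move=> q; apply: cvgD; [exact: c1'|exact: c2'].
  have c4' : continuous (fun q : E * E => q.1 - h *: q.2).
    by move=> q; apply: cvgB; [exact: c1'|exact: c2'].
  have u1 : continuous (fun q : E * E => u q.1).
    by move=> q; exact: (continuous_comp (c1' q) (@uc _)).
  have u2 : continuous (fun q : E * E => u (q.1 + h *: q.2)).
    by move=> q; exact: (continuous_comp (c3' q) (@uc _)).
  have u3 : continuous (fun q : E * E => u (q.1 - h *: q.2)).
    by move=> q; exact: (continuous_comp (c4' q) (@uc _)).
  move=> q; apply: cvgM; first exact: cvg_cst.
  apply: cvgB; first by apply: cvgD; [exact: u2|exact: u3].
  by apply: cvgM; [exact: cvg_cst|exact: u1].
have hk (k : E) : `|k| <= 2 -> h * `|k| < r.
  move=> k2; apply: (@le_lt_trans _ _ (h * 2)); first by rewrite ler_pM2l.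
  lra.
have [|z [k [zr k2 Pe Pmin]]] := minE Theta Thetac.
  move=> z k zr k2; apply: (@second_difference_approx R n u z k h r e uC h0 _ (hk k k2)).
  by move=> y' y'r; exact: Hr.
have zr' := ltW zr; have k2' := ltW k2.
set sg := dot k k - 1.
(* The penalty is small at the minimum because the second difference is
   nonnegative. *)
have sg2 : sg ^+ 2 <= eps * M.
  have EM : eps * M = eps * (2 * d0) + eps by rewrite /M mulrDr mulr1.
  rewrite EM; move: Pe; have : 0 <= Theta (z, k).
    by rewrite mulr_ge0 ?invr_ge0 ?(ltW h2)//; exact: convex_second_difference.
  rewrite -/sg; have : eps * phi z <= eps * (2 * d0) by rewrite ler_pM2l// phi_le.
  move: (Theta _) (eps * phi z) (eps * (2 * d0)) => *; lra.
pose rho' := Num.min (rho - `|z - x0|) (2 - `|k|).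
have rho'0 : 0 < rho' by rewrite lt_min !subr_gt0 zr.
have [|px py SV] := @interior_minimum_conditions R n u y z k d0 K X h rho' uC h0 rho'0.
  move=> z' k' z'r k'r.
  have z'x : `|z' - x0| <= rho.
    have : rho' <= rho - `|z - x0| by rewrite ge_min lexx.
    have : `|z' - x0| <= `|z' - z| + `|z - x0|.
      by apply: (le_trans _ (ler_normD _ _)); rewrite addrA subrK.
    lra.
  have k'2 : `|k'| <= 2.
    have : rho' <= 2 - `|k| by rewrite ge_min lexx orbT.
    have : `|k'| <= `|k' - k| + `|k|.
      by apply: (le_trans _ (ler_normD _ _)); rewrite subrK.
    lra.
  have := Pmin z' k' z'x k'2; rewrite -(ler_pM2l h2).
  have E1 z1 k1 : h ^+ 2 * (Theta (z1, k1) - eps * phi z1 + (dot k1 k1 - 1) ^+ 2) =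
    u (z1 + h *: k1) + u (z1 - h *: k1) - 2 * u z1 - X * barrier y d0 K z1
     + h ^+ 2 * (dot k1 k1 - 1) ^+ 2.
    rewrite /Theta /X /phi /=.
    move: (u _) (u _) (u _) (barrier _ _ _ _) (dot k1 k1) => *.
    by field; rewrite gt_eqF.
  by rewrite !E1.
set B := 1 + 2 * K * paraboloid y d0 z in SV px py.
have [psiz1 psiz2] := psiK z zr'.
have B32 : `|B| <= 3 / 2.
  rewrite /B -/(psi z); move: psiz1; rewrite !ler_norml => /andP[a1 a2].
  by apply/andP; split; lra.
have ZE : dot (z - y) (z - y) = d0 - psi z by rewrite /psi /paraboloid; ring.
have Zn : `|z - y| <= M.
  apply: norm_le_dot; first exact: ltW.
  rewrite ZE; move: psiz2; rewrite ler_norml /M => /andP[a1 a2]; nra.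
have Zd0 : d0 / 2 <= dot (z - y) (z - y).
  by rewrite ZE; move: psiz2; rewrite ler_norml => /andP[a1 a2]; lra.
set dl := (- 2 * sg * h) *: k in px py SV.
set d := (- X * B) *: (z - y) in px py SV.
have dl2 : `|dl| ^+ 2 <= c1 * X.
  rewrite normrZ exprMn real_normK ?num_real//.
  have -> : c1 * X = 4 * h ^+ 2 * (eps * M) * 4 by rewrite /c1 /X; ring.
  rewrite ler_pM ?sqr_ge0//.
    have -> : (- 2 * sg * h) ^+ 2 = 4 * h ^+ 2 * sg ^+ 2 by ring.
    by rewrite ler_pM2l// mulr_gt0.
  by rewrite expr2 (_ : 4 = 2 * 2) ?ler_pM// -natrM.
have dX : `|d| <= c2 * X.
  rewrite normrZ normrM normrN (gtr0_norm X0) /c2.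
  have -> : 2 * M * X = X * 2 * M by ring.
  apply: ler_pM => //; first by rewrite mulr_ge0// ltW.
  by apply: ler_wpM2l; [exact: ltW|apply: (le_trans B32); lra].
have c1pos : 0 < c1 by rewrite mulr_gt0.
have c2pos : 0 < c2 by rewrite mulr_gt0.
have c1X : c1 * X <= 1.
  apply: (@le_trans _ _ (h * c1)); first by rewrite mulrC ler_pM2r.
  apply: le_trans hc; rewrite ler_pM2l// -addrA addrCA lerDl.
  by apply: addr_ge0; [exact: ler01|exact: ltW].
have c2X : c2 * X <= 1.
  apply: (@le_trans _ _ (h * c2)); first by rewrite mulrC ler_pM2r.
  apply: le_trans hc; rewrite ler_pM2l// lerDr.
  by apply: addr_ge0; [exact: ler01|exact: ltW].
have dl1 : `|dl| <= 1.
  by rewrite -(@ler_pXn2r _ 2)//= ?nnegrE// expr1n (le_trans dl2).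
have d1 : `|d| <= 1 by apply: (le_trans dX).
have near3 (s : E) : `|s| = h * `|k| -> `|z + s - x0| <= 3.
  move=> sE; rewrite addrAC (le_trans (ler_normD _ _))// sE.
  have hk2 : h * `|k| <= 1 * 2 by rewrite ler_pM// ltW.
  by apply: (le_trans (lerD zr' hk2)); move: rho1; clear; lra.
have nhk : `|h *: k| = h * `|k| by rewrite normrZ gtr0_norm.
have nhk' : `|- (h *: k)| = h * `|k| by rewrite normrN.
have pdex := pde (z + h *: k); have pdey := pde (z - h *: k); have pdez := pde z.
rewrite px in pdex; rewrite py in pdey.
have z3 : `|z - x0| <= 3 by apply: (le_trans zr'); apply: (le_trans rho1); rewrite ler1n.
have key := @summed_second_variation R n (hessian u (z + h *: k)) (hessian u (z - h *: k))
  (hessian u z) (gradient u z) dl d (z - y) k c w0 c1 c2 X B K sg pdex pdey pdez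
  (fun i j => cH _ i j (near3 _ nhk)) (fun i j => cH _ i j (near3 _ nhk'))
  c0 w00 (ltW X0) (ltW c2pos) (ltW K0) (w0H z z3)
  dl1 d1 dl2 dX (le_trans (ler_norm _) B32) k2' erefl SV.
have : X * (`|C| + 1) <= C * X.
  apply: le_trans key.
  have -> : X * (`|C| + 1) = 8 * K * X * w0 * (d0 / 2).
    by rewrite /K; field; rewrite !gt_eqF.
  have KXw : 0 <= 8 * K * X * w0.
    by apply/ltW/mulr_gt0 => //; apply: mulr_gt0 => //; apply: mulr_gt0.
  exact: ler_wpM2l.
rewrite mulrC ler_pM2r// leNgt => /negP; apply.
by apply: (le_lt_trans (ler_norm _)); rewrite ltrDl.
Qed.
End Final.

Theorem theorem1p3 (R : realType) (n : nat) (u : 'rV[R]_n -> R)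
  (u_convex : @convex_function R 'rV[R]_n [set: 'rV[R]_n] u)
  (u_solution : classical_solution u) :
  Omega0 u !=set0 -> Omega0 u = [set: 'rV[R]_n].
Proof.
move=> [y0 y0pos]; have [uC _] := u_solution.
rewrite -subTset => x1 _.
suff : posbil (hessian u x1) by move=> H; split; [exact: hessian_sym|exact: H].
apply: contrapT => x1neg.
have [x0 [e0 [y [d00 e01 He0 ball_pos]]]] :=
  touching_ball (fun i j => @hessian_continuous R n u i j uC) y0pos.2 x1neg.
apply: (no_degenerate_touching uC u_convex _ _ d00 e01 He0 ball_pos) => x.
  by have [] := solution_nondivergence x u_solution.
by have [] := solution_nondivergence x u_solution.
Qed.
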